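(* Let $E, F$ be real Banach spaces and let $E_0$ be a subspace of $E$. Let $\mathcal A$ be a maximal Banach operator ideal and $T\in \mathcal A(E_0,F')$. The following are equivalent: (1) There exists $R\in \mathcal A(E,F')$ such that $R|_{E_0}=T$ and $\|R\|_{\mathcal A}=\|T\|_{\mathcal A}$. (2) For every maximal Banach Lipschitz operator ideal $\mathcal I$ invariant under translations such that $\mathcal I\cap \mathcal L=\mathcal A$, there exists a Lipschitz function $f\in \mathcal I(E,F')$ such that $f|_{E_0}=T$ and $\|f\|_{\mathcal I}=\|T\|_{\mathcal A}$. (3) There exist a maximal Banach Lipschitz operator ideal $\mathcal I$ invariant under translations such that $\mathcal I\cap \mathcal L=\mathcal A$ and a Lipschitz function $f\in \mathcal I(E,F')$ with $f|_{E_0}=T$ and $\|f\|_{\mathcal I}=\|T\|_{\mathcal A}$.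
   Context: All Banach spaces are real. $E'$ denotes the (topological) dual of $E$, and $\mathcal L(E,F)$ is the space of bounded linear operators from $E$ to $F$. A Banach operator ideal means a Banach ideal of bounded linear operators between Banach spaces in the sense of Pietsch; a Banach operator ideal $\mathcal A$ is maximal if it equals its maximal hull isometrically, i.e. $T\in\mathcal L(E,F)$ belongs to $\mathcal A(E,F)$ iff $\sup\|Q\circ T\circ\iota\|_{\mathcal A(G,F/M)}<\infty$ (supremum over finite-dimensional subspaces $G\subset E$ with inclusion $\iota$ and closed cofinite-dimensional subspaces $M\subset F$ with quotient map $Q$), and then this supremum equals $\|T\|_{\mathcal A}$. Pointed metric spaces have distinguished point denoted $0$; every Banach space is a pointed metric space with distinguished point $0$, and a subset containing $0$ is a pointed metric space with the same distinguished point. For pointed metric spaces $X,Y$, $\mathrm{Lip}_0(X,Y)$ is the set of Lipschitz maps $f\colon X\to Y$ with $f(0)=0$, and $\mathrm{Lip}(f)$ is the least Lipschitz constant of $f$. Banach Lipschitz operator ideal: a subclass $\mathcal I$ of $\mathrm{Lip}_0$ together with a function $\|\cdot\|_{\mathcal I}\colon \mathcal I\to[0,\infty)$ such that, writing $\mathcal I(X,E)=\mathrm{Lip}_0(X,E)\cap\mathcal I$ for a pointed metric space $X$ and a Banach space $E$: (i) $\mathcal I(X,E)$ is a linear subspace of $\mathrm{Lip}_0(X,E)$, $(\mathcal I(X,E),\|\cdot\|_{\mathcal I})$ is a Banach space, and $\mathrm{Lip}(f)\le\|f\|_{\mathcal I}$ for all $f\in\mathcal I(X,E)$; (ii) $Id_{\mathbb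 R}\in\mathcal I(\mathbb R,\mathbb R)$ and $\|Id_{\mathbb R}\|_{\mathcal I}=1$; (iii) if $g\in\mathrm{Lip}_0(Y,X)$, $f\in\mathcal I(X,E)$ and $S\in\mathcal L(E,F)$, then $S\circ f\circ g\in\mathcal I(Y,F)$ and $\|S\circ f\circ g\|_{\mathcal I}\le \mathrm{Lip}(g)\,\|f\|_{\mathcal I}\,\|S\|$. $\mathcal I\cap\mathcal L$ denotes the class of bounded linear operators between Banach spaces that belong to $\mathcal I$, with the norm $\|\cdot\|_{\mathcal I}$; it is a Banach operator ideal. Equality $\mathcal I\cap\mathcal L=\mathcal A$ means equality of all components with equal norms. Maximal hull: $f\in \mathrm{Lip}_0(X,E)$ belongs to $\mathcal I^{\max}(X,E)$ if $\|f\|_{\mathcal I^{\max}}:=\sup\|Q\circ f\circ\iota\|_{\mathcal I(X_0,E/M)}<\infty$, the supremum being over all finite metric subspaces $X_0\subset X$ (containing $0$) and all (closed) cofinite-dimensional subspaces $M$ of $E$, where $\iota\colon X_0\to X$ is the inclusion and $Q\colon E\to E/M$ the quotient map. $\mathcal I$ is maximal if $\mathcal I=\mathcal I^{\max}$ with equal norms. Translations: for $X\subset E$ with $0\in X$, $x_0\in X$ and $f\colon X\to F$, put $X-x_0=\{x-x_0\colon x\in X\}$ and $f^{x_0}\colon X-x_0\to F$, $f^{x_0}(z)=f(z+x_0)-f(x_0)$. $\mathcal I$ is invariant under translations if for all Banach spaces $E,F$, every subset $X\subset E$ with $0\in X$, every $x_0\in X$ and every Lipschitz map $f\colon X\to F$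 with $f(0)=0$, one has $f\in\mathcal I(X,F)$ if and only if $f^{x_0}\in\mathcal I(X-x_0,F)$, with $\|f\|_{\mathcal I}=\|f^{x_0}\|_{\mathcal I}$. *)

(* Defs.v *)
From HB Require Import structures.
From mathcomp Require Import all_boot all_order all_algebra.
From mathcomp Require Import generic_quotient ring_quotient.
From mathcomp Require Import all_classical all_reals all_analysis.
Set Implicit Arguments.
Unset Strict Implicit.
Unset Printing Implicit Defensive.
Import Order.TTheory GRing.Theory Num.Theory.
Import numFieldNormedType.Exports.
Local Open Scope classical_set_scope.
Local Open Scope ring_scope.

Section BoundedLinear.
Context (R : realType).

Definition bounded_linear (E F : normedModType R) (f : E -> F) : Prop :=
  linear f /\ exists C : R, forall x, `|f x| <= C * `|x|.

Definition opnorm (E F : normedModType R) (f : E -> F) : R :=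
  sup [set `|f x| | x in [set x : E | `|x| <= 1]].

Lemma opnorm_has_sup (E F : normedModType R) (f : E -> F) :
  bounded_linear f -> has_sup [set `|f x| | x in [set x : E | `|x| <= 1]].
Proof.
move=> [lf [C fC]]; split; first by exists `|f 0|, 0 => //=; rewrite normr0.
exists `|C| => _ [x /= x1 <-]; apply: (le_trans (fC x)).
apply: (@le_trans _ _ (`|C| * `|x|)); first by rewrite ler_wpM2r// ler_norm.
by rewrite ler_piMr.
Qed.

Lemma opnorm_ge0 (E F : normedModType R) (f : E -> F) :
  bounded_linear f -> 0 <= opnorm f.
Proof.
move=> bf; apply: (@le_trans _ _ `|f 0|) => //.
by apply: sup_upper_bound; [exact: opnorm_has_sup|exists 0 => //=; rewrite normr0].
Qed.

Lemma linear_fun0 (E F : lmodType R) (f : E -> F) : linear f -> f 0 = 0.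
Proof. by move=> lf; have := lf (-1) 0 0; rewrite scaler0 add0r scaleN1r addNr. Qed.

Lemma linear_funZ (E F : lmodType R) (f : E -> F) a x : linear f -> f (a *: x) = a *: f x.
Proof. by move=> lf; have := lf a x 0; rewrite !addr0 linear_fun0// addr0. Qed.

Lemma opnorm_le (E F : normedModType R) (f : E -> F) x :
  bounded_linear f -> `|f x| <= opnorm f * `|x|.
Proof.
move=> bf; have [->|x0] := eqVneq x 0.
  by rewrite linear_fun0 ?normr0 ?mulr0//; exact: bf.1.
have nx : 0 < `|x| by rewrite normr_gt0.
have -> : `|f x| = `|f (`|x|^-1 *: x)| * `|x|.
  rewrite linear_funZ; last exact: bf.1.
  by rewrite normrZ normfV normr_id mulrC mulrA divff ?mul1r// gt_eqF.
rewrite ler_wpM2r//; apply: sup_upper_bound; first exact: opnorm_has_sup.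
exists (`|x|^-1 *: x) => //=.
by rewrite normrZ normfV normr_id mulVf// gt_eqF.
Qed.

Lemma le_opnorm (E F : normedModType R) (f : E -> F) (C : R) :
  0 <= C -> (forall x, `|f x| <= C * `|x|) -> opnorm f <= C.
Proof.
move=> C0 fC; apply: ge_sup.
  by exists `|f 0|, 0 => //=; rewrite normr0.
by move=> _ [x /= x1 <-]; apply: (le_trans (fC x)); rewrite ler_piMr.
Qed.

Lemma fast_cauchy_complete (V : normedModType R) :
  (forall u : nat -> V,
     (forall n m, (n <= m)%N -> `|u m - u n| <= 2^-1 ^+ n) ->
     exists l : V, u n @[n --> \oo] --> l) ->
  forall F : set_system V, ProperFilter F -> cauchy F -> cvg F.
Proof.
move=> H F FF /cauchyP Fc.
have e0 n : 0 < 2^-1 ^+ n / 2 :> R by rewrite divr_gt0// exprn_gt0.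
have /choice[u uF] : forall n, exists x, F (ball x (2^-1 ^+ n / 2)).
  by move=> n; exact: Fc.
have [n m nm|l ul] := H u.
  have : F (ball (u n) (2^-1 ^+ n / 2) `&` ball (u m) (2^-1 ^+ m / 2)).
    exact: filterI.
  move=> /filter_ex [z []].
  rewrite -ball_normE /ball_/= => nz mz.
  have -> : u m - u n = (u m - z) - (u n - z) by rewrite opprB addrA subrK.
  rewrite (le_trans (ler_normB _ _))// [leRHS]splitr addrC lerD ?ltW//.
  rewrite (lt_le_trans mz)// ler_pM2r// ler_wiXn2l// ?invr_ge0//.
  by rewrite invf_le1// ler1n.
apply/cvg_ex; exists l; apply/cvgrPdist_lt => e egt0.
have e20 : 0 < e / 2 by rewrite divr_gt0.
have c0 : (2^-1 ^+ n / 2 : R) @[n --> \oo] --> (0 : R).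
  rewrite -[X in _ --> X](mul0r 2^-1); apply: cvgMl.
  by apply: cvg_expr; rewrite ger0_norm// invf_lt1// ltr1n.
near \oo => n.
have : F (ball (u n) (2^-1 ^+ n / 2)) by exact: uF.
apply: filterS => z; rewrite -ball_normE /ball_/= => uz.
rewrite -(subrKA (u n)) (le_lt_trans (ler_normD _ _))// (splitr e) ltrD//.
  by near: n; move/cvgrPdist_lt : ul; exact.
apply: (lt_trans uz); near: n.
move/cvgrPdist_lt : c0 => /(_ _ e20); apply: filterS => n.
by rewrite sub0r normrN ger0_norm// ltW.
Unshelve. all: by end_near. Qed.

End BoundedLinear.

Section Subspaces.
Context (R : realType) (E : completeNormedModType R).

(* Only closed subspaces are Banach spaces, or give normed quotients. *)
Record closedSubspace := ClosedSubspace {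
  cs_set :> set E;
  cs_set0 : cs_set 0;
  cs_setP : forall a x y, cs_set x -> cs_set y -> cs_set (a *: x + y);
  cs_closed : closed cs_set }.

Definition cs_pred (M : closedSubspace) : {pred E} := fun x => x \in cs_set M.

Lemma cs_predP M x : x \in cs_pred M <-> cs_set M x.
Proof. by split=> [/set_mem|/mem_set]. Qed.

Lemma cs_submod_closed M : submod_closed (cs_pred M).
Proof.
split=> [|a x y]; first by apply/cs_predP; exact: cs_set0.
by move=> /cs_predP Mx /cs_predP My; apply/cs_predP; exact: cs_setP.
Qed.

HB.instance Definition _ M :=
  GRing.isSubmodClosed.Build R E (cs_pred M) (cs_submod_closed M).

Record subsp (M : closedSubspace) : Type :=
  SubSp { subsp_val : E; subsp_valP : subsp_val \in cs_pred M }.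

Section SubspaceStructure.
Context (M : closedSubspace).

HB.instance Definition _ := [isSub for @subsp_val M].
HB.instance Definition _ := [Choice of subsp M by <:].
HB.instance Definition _ := [SubChoice_isSubLmodule of subsp M by <:].

Definition subsp_norm (x : subsp M) : R := `|subsp_val x|.

Lemma subsp_normD x y : subsp_norm (x + y) <= subsp_norm x + subsp_norm y.
Proof. exact: ler_normD. Qed.

Lemma subsp_normZ l x : subsp_norm (l *: x) = `|l| * subsp_norm x.
Proof. exact: normrZ. Qed.

Lemma subsp_norm_eq0 x : subsp_norm x = 0 -> x = 0.
Proof. by move=> /normr0_eq0 x0; exact: val_inj. Qed.

HB.instance Definition _ :=
  Lmodule_isNormed.Build R (subsp M) subsp_normD subsp_normZ subsp_norm_eq0.

Lemma subsp_complete (F : set_system (subsp M)) :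
  ProperFilter F -> cauchy F -> cvg F.
Proof.
apply: fast_cauchy_complete => u uc.
have uvc n m : (n <= m)%N -> `|subsp_val (u m) - subsp_val (u n)| <= 2^-1 ^+ n.
  exact: uc.
have /cvg_ex[l ul] : cvg ((subsp_val (u n)) @[n --> \oo]).
  apply: cauchy_cvg; apply/cauchyP => e e0.
  have c0 : (2^-1 ^+ n : R) @[n --> \oo] --> (0 : R).
    by apply: cvg_expr; rewrite ger0_norm// invf_lt1// ltr1n.
  move/cvgrPdist_lt : c0 => /(_ _ e0)[N _ /(_ _ (leqnn N)) Ne].
  exists (subsp_val (u N)); exists N => // n /= Nn.
  rewrite -ball_normE /ball_/= distrC (le_lt_trans (uvc _ _ Nn))//.
  by move: Ne; rewrite sub0r normrN ger0_norm.
have Ml : cs_set M l.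
  apply: (closed_cvg (cs_set M) (cs_closed (c:=M)) _ _ ul).
  by apply: nearW => n; apply/cs_predP; exact: subsp_valP.
exists (SubSp ((cs_predP M l).2 Ml)); apply/cvgrPdist_lt => e e0.
by move/cvgrPdist_lt : ul => /(_ _ e0).
Qed.

HB.instance Definition _ := Uniform_isComplete.Build (subsp M) subsp_complete.

End SubspaceStructure.
End Subspaces.

Section Quotients.
Context (R : realType) (E : completeNormedModType R) (M : closedSubspace E).
Local Open Scope quotient_scope.

Definition quotsp : Type := Quotient.quot (cs_pred M : zmodClosed E).

HB.instance Definition _ := GRing.Zmodule.on quotsp.
HB.instance Definition _ := EqQuotient.on quotsp.

Definition quot_pi (x : E) : quotsp := \pi_quotsp x.

Lemma quot_pi_eq x y : quot_pi x = quot_pi y <-> cs_set M (x - y).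
Proof.
rewrite -cs_predP; split=> [|xy].
  by move/eqP; rewrite /quot_pi -(Quotient.idealrBE (cs_pred M : zmodClosed E)).
by apply/eqP; rewrite /quot_pi -(Quotient.idealrBE (cs_pred M : zmodClosed E)).
Qed.

Lemma quot_piD x y : quot_pi (x + y) = quot_pi x + quot_pi y.
Proof. exact: (raddfD (\pi_(Quotient.quot (cs_pred M : zmodClosed E)))). Qed.

Lemma quot_piN x : quot_pi (- x) = - quot_pi x.
Proof. exact: (raddfN (\pi_(Quotient.quot (cs_pred M : zmodClosed E)))). Qed.

Lemma quot_pi_repr (q : quotsp) : quot_pi (repr q) = q.
Proof. by rewrite /quot_pi reprK. Qed.

Definition quot_scale (a : R) (q : quotsp) : quotsp := quot_pi (a *: repr q).

Lemma quot_piZ a x : quot_pi (a *: x) = quot_scale a (quot_pi x).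
Proof.
apply/quot_pi_eq; rewrite -scalerBr -[_ *: _]addr0.
by apply: cs_setP; [apply/quot_pi_eq; rewrite quot_pi_repr|exact: cs_set0].
Qed.

Lemma quot_scaleA a b q : quot_scale a (quot_scale b q) = quot_scale (a * b) q.
Proof. by rewrite -[q]quot_pi_repr -!quot_piZ scalerA. Qed.

Lemma quot_scale1 : left_id 1 quot_scale.
Proof. by move=> q; rewrite -[q]quot_pi_repr -!quot_piZ scale1r. Qed.

Lemma quot_scaleDr : right_distributive quot_scale +%R.
Proof.
move=> a p q; rewrite -[p]quot_pi_repr -[q]quot_pi_repr.
by rewrite -quot_piD -!quot_piZ scalerDr quot_piD.
Qed.

Lemma quot_scaleDl q : {morph quot_scale^~ q : a b / a + b}.
Proof.
by move=> a b; rewrite -[q]quot_pi_repr -!quot_piZ scalerDl quot_piD.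
Qed.

HB.instance Definition _ := GRing.Zmodule_isLmodule.Build R quotsp
  quot_scaleA quot_scale1 quot_scaleDr quot_scaleDl.

Definition quot_norm (q : quotsp) : R := inf [set `|x| | x in quot_pi @^-1` [set q]].

Lemma quot_norm_has_inf q : has_inf [set `|x| | x in quot_pi @^-1` [set q]].
Proof.
split; first by exists `|repr q|, (repr q) => //=; exact: quot_pi_repr.
by exists 0 => _ [x _ <-].
Qed.

Lemma quot_norm_ge0 q : 0 <= quot_norm q.
Proof. by apply: lb_le_inf => [|_ [x _ <-]//]; exact: (quot_norm_has_inf q).1. Qed.

Lemma quot_norm_le x : quot_norm (quot_pi x) <= `|x|.
Proof. by apply: ge_inf; [exact: (quot_norm_has_inf _).2|exists x]. Qed.

Lemma quot_norm_lift q e : 0 < e -> exists2 x, quot_pi x = q & `|x| < quot_norm q + e.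
Proof.
by move=> e0; have [_ [x xq <-] xe] := inf_adherent e0 (quot_norm_has_inf q); exists x.
Qed.

Lemma quot_normD p q : quot_norm (p + q) <= quot_norm p + quot_norm q.
Proof.
apply/ler_addgt0Pl => e e0; have e20 : 0 < e / 2 by rewrite divr_gt0.
have [x xp xe] := quot_norm_lift p e20; have [y yq ye] := quot_norm_lift q e20.
rewrite -{1}xp -{1}yq -quot_piD (le_trans (quot_norm_le _))//.
rewrite (le_trans (ler_normD _ _))// (splitr e) addrACA addrC.
by rewrite [leRHS]addrC lerD// addrC ltW// [ltRHS]addrC// -?xp.
Qed.

Lemma quot_normZ_le l q : quot_norm (l *: q) <= `|l| * quot_norm q.
Proof.
apply/ler_addgt0Pl => e e0.
have l1 : 0 < `|l| + 1 by rewrite ltr_wpDl.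
have el : 0 < e / (`|l| + 1) by rewrite divr_gt0.
have [x xq xe] := quot_norm_lift q el.
rewrite -{1}xq; have -> : l *: quot_pi x = quot_pi (l *: x) by rewrite quot_piZ.
rewrite (le_trans (quot_norm_le _))// normrZ.
rewrite (@le_trans _ _ (`|l| * (quot_norm q + e / (`|l| + 1))))//.
  by rewrite ler_wpM2l// ltW.
rewrite mulrDr addrC lerD2r mulrCA ler_piMr// 1?ltW//.
by rewrite ltr_pdivrMr// mul1r ltrDl.
Qed.

Lemma quot_normZ l q : quot_norm (l *: q) = `|l| * quot_norm q.
Proof.
apply/eqP; rewrite eq_le quot_normZ_le/=.
have [->|l0] := eqVneq l 0; first by rewrite normr0 mul0r quot_norm_ge0.
rewrite -{1}[q](scalerK l0) -ler_pdivlMl ?normr_gt0// -normfV.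
exact: quot_normZ_le.
Qed.

Lemma quot_norm_eq0 q : quot_norm q = 0 -> q = 0.
Proof.
move=> q0; rewrite -[q]quot_pi_repr.
have -> : (0 : quotsp) = quot_pi 0 by rewrite -[in RHS](subrr 0) quot_piD quot_piN subrr.
apply/quot_pi_eq; rewrite subr0.
apply: (cs_closed (c:=M)) => B /nbhs_ballP[e /= e0 eB].
have [x xq xe] := quot_norm_lift q e0.
exists (repr q - x); split.
  by apply/quot_pi_eq; rewrite quot_pi_repr.
by apply: eB; rewrite -ball_normE /ball_/= opprB addrC subrK; rewrite q0 add0r in xe.
Qed.

HB.instance Definition _ :=
  Lmodule_isNormed.Build R quotsp quot_normD quot_normZ quot_norm_eq0.

Lemma quot_complete (F : set_system quotsp) : ProperFilter F -> cauchy F -> cvg F.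
Proof.
apply: fast_cauchy_complete => u uc.
have /choice[d dP] n : exists x,
    quot_pi x = u n.+1 - u n /\ `|x| <= 2 * 2^-1 ^+ n.
  have e0 : 0 < 2^-1 ^+ n :> R by rewrite exprn_gt0.
  have [x xu xe] := quot_norm_lift (u n.+1 - u n) e0.
  exists x; split => //; apply: (le_trans (ltW xe)).
  by rewrite mulr_natl mulr2n lerD2r; exact: uc.
have dc : cvgn (series d).
  apply: normed_cvg; apply: (@series_le_cvg _ _ (geometric 2 2^-1)).
  - by move=> n; exact: normr_ge0.
  - by move=> n; rewrite /= mulr_ge0// exprn_ge0.
  - by move=> n; exact: (dP n).2.
  - by apply: is_cvg_geometric_series; rewrite ger0_norm// invf_lt1// ltr1n.
have ud n : u n = quot_pi (repr (u 0) + series d n).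
  elim: n => [|n IH]; first by rewrite /series/= big_geq// addr0 quot_pi_repr.
  have -> : series d n.+1 = series d n + d n.
    by rewrite /series/= big_nat_recr.
  by rewrite addrA quot_piD -IH (dP n).1 addrC subrK.
move/cvg_ex : dc => [s ds]; exists (quot_pi (repr (u 0) + s)).
apply/cvgrPdist_lt => e e0; move/cvgrPdist_lt : ds => /(_ _ e0).
apply: filterS => n; apply: le_lt_trans; rewrite (ud n) -quot_piN -quot_piD.
by rewrite (le_trans (quot_norm_le _))// opprD addrACA subrr add0r.
Qed.

HB.instance Definition _ := Uniform_isComplete.Build quotsp quot_complete.

End Quotients.

Section Dual.
Context (R : realType) (E : completeNormedModType R).

Definition functional_pred : {pred E -> R^o} :=
  fun f => f \in [set f | bounded_linear f].

Lemma functional_predP (f : E -> R^o) : f \in functional_pred <-> bounded_linear f.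
Proof. by split=> [/set_mem|/mem_set]. Qed.

Lemma functional_submod_closed : submod_closed functional_pred.
Proof.
split=> [|a f g].
  have z x : (0 : E -> R^o) x = 0 by [].
  apply/functional_predP; split; first by move=> a x y; rewrite !z scaler0 addr0.
  by exists 0 => x; rewrite z mul0r normr0.
move=> /functional_predP[lf [C fC]] /functional_predP[lg [D gD]].
apply/functional_predP; split=> [b x y|].
  have z w : (a *: f + g) w = a *: f w + g w by [].
  rewrite !z lf lg !scalerDr !scalerA [b * a]mulrC.
  by rewrite -!addrA; congr (_ + _); rewrite addrCA.
exists (`|a| * C + D) => x; rewrite mulrDl (le_trans (ler_normD _ _))//.
by rewrite lerD// normrZ -mulrA ler_wpM2l.
Qed.

HB.instance Definition _ :=
  GRing.isSubmodClosed.Build R (E -> R^o) functional_pred functional_submod_closed.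

Record dual : Type :=
  Dual { dual_fun :> E -> R^o; dual_funP : dual_fun \in functional_pred }.

HB.instance Definition _ := [isSub for dual_fun].
HB.instance Definition _ := [Choice of dual by <:].
HB.instance Definition _ := [SubChoice_isSubLmodule of dual by <:].

Lemma dual_bounded_linear (f : dual) : bounded_linear f.
Proof. exact/functional_predP/dual_funP. Qed.

Definition dual_norm (f : dual) : R := opnorm f.

Lemma dual_normD f g : dual_norm (f + g) <= dual_norm f + dual_norm g.
Proof.
apply: le_opnorm => [|x]; first by rewrite addr_ge0// opnorm_ge0//; exact: dual_bounded_linear.
rewrite (le_trans (ler_normD _ _))// mulrDl lerD//; apply: opnorm_le;
  exact: dual_bounded_linear.
Qed.

Lemma dual_normZ_le l f : dual_norm (l *: f) <= `|l| * dual_norm f.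
Proof.
apply: le_opnorm => [|x].
  by rewrite mulr_ge0// opnorm_ge0//; exact: dual_bounded_linear.
have -> : (l *: f : dual) x = l *: f x by [].
by rewrite normrZ -mulrA ler_wpM2l// opnorm_le//; exact: dual_bounded_linear.
Qed.

Lemma dual_normZ l f : dual_norm (l *: f) = `|l| * dual_norm f.
Proof.
apply/eqP; rewrite eq_le dual_normZ_le/=.
have [->|l0] := eqVneq l 0.
  by rewrite normr0 mul0r opnorm_ge0//; exact: dual_bounded_linear.
rewrite -{1}[f](scalerK l0) -ler_pdivlMl ?normr_gt0// -normfV.
exact: dual_normZ_le.
Qed.

Lemma dual_norm_eq0 f : dual_norm f = 0 -> f = 0.
Proof.
move=> f0; apply: val_inj; apply/funext => x; apply/normr0_eq0/eqP.
rewrite eq_le normr_ge0 andbT.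
have := opnorm_le x (dual_bounded_linear f).
by rewrite -/(dual_norm f) f0 mul0r.
Qed.

HB.instance Definition _ :=
  Lmodule_isNormed.Build R dual dual_normD dual_normZ dual_norm_eq0.

Lemma dual_complete (F : set_system dual) : ProperFilter F -> cauchy F -> cvg F.
Proof.
apply: fast_cauchy_complete => u uc.
have c0 : (2^-1 ^+ n : R) @[n --> \oo] --> (0 : R).
  by apply: cvg_expr; rewrite ger0_norm// invf_lt1// ltr1n.
have uxc n m x : (n <= m)%N -> `|u m x - u n x| <= 2^-1 ^+ n * `|x|.
  move=> nm; apply: (@le_trans _ _ (dual_norm (u m - u n) * `|x|)).
    exact: (opnorm_le x (dual_bounded_linear (u m - u n))).
  by rewrite ler_wpM2r//; exact: uc.
have /choice[l ul] x : exists l : R^o, u n x @[n --> \oo] --> l.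
  apply/cvg_ex; apply: cauchy_cvg; apply/cauchyP => e e0.
  have x1 : 0 < `|x| + 1 by rewrite ltr_wpDl.
  have ex : 0 < e / (`|x| + 1) by rewrite divr_gt0.
  move/cvgrPdist_lt : (c0) => /(_ _ ex)[N _ /(_ _ (leqnn N)) Ne].
  exists (u N x); exists N => // n /= Nn.
  rewrite -ball_normE /ball_/= distrC (le_lt_trans (uxc _ _ x Nn))//.
  move: Ne; rewrite sub0r normrN ger0_norm// ltr_pdivlMr//.
  by apply: le_lt_trans; rewrite ler_wpM2l// lerDl.
have ll : linear l.
  move=> a x y; apply: (cvg_unique (@norm_hausdorff _ R^o) (ul _)).
  have -> : (fun n => u n (a *: x + y)) = (fun n => a *: u n x + u n y).
    by apply/funext => n; rewrite (dual_bounded_linear (u n)).1.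
  by apply: cvgD; [apply: cvgZl_tmp; exact: ul|exact: ul].
have lu n x : `|l x - u n x| <= 2^-1 ^+ n * `|x|.
  have lc : (u m x - u n x : R^o) @[m --> \oo] --> (l x - u n x : R^o).
    by apply: cvgB; [exact: ul|exact: cvg_cst].
  move/cvg_norm : lc => lc.
  apply: (closed_cvg _ (@closed_le R (2^-1 ^+ n * `|x|)) _ _ lc).
  by exists n => // m /= nm; exact: uxc.
have bl : bounded_linear (l : E -> R^o).
  split=> //; exists (1 + dual_norm (u 0)) => x.
  rewrite -[l x](subrK (u 0 x)) (le_trans (ler_normD _ _))// mulrDl lerD//.
  exact: (opnorm_le x (dual_bounded_linear (u 0))).
exists (Dual ((functional_predP l).2 bl)); apply/cvgrPdist_le => e e0.
move/cvgrPdist_le : c0 => /(_ _ e0); apply: filterS => n.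
rewrite sub0r normrN ger0_norm//; apply: le_trans.
by apply: le_opnorm => // x; exact: lu.
Qed.

HB.instance Definition _ := Uniform_isComplete.Build dual dual_complete.

End Dual.

Definition finite_dim (R : realType) (V : lmodType R) : Prop :=
  exists (n : nat) (b : 'I_n -> V),
    forall v, exists c : 'I_n -> R, v = \sum_(i < n) c i *: b i.

#[short(type="pointedMetricType")]
HB.structure Definition PointedMetric (R : numDomainType) :=
  {X of Metric R X & isPointed X}.

Section PointedMetricSpaces.
Context (R : realType).

(* A Banach space seen as a pointed metric space. An alias is needed since the
   [point] that the library attaches to a normed module need not be 0. *)
Definition banach_pm (E : completeNormedModType R) : Type := E.

Section BanachPM.
Context (E : completeNormedModType R).

Definition banach_dist (x y : banach_pm E) : R := `|(x : E) - (y : E)|.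

Lemma banach_distxx x : banach_dist x x = 0.
Proof. by rewrite /banach_dist subrr normr0. Qed.

Lemma banach_dist_eq0 x y : banach_dist x y = 0 -> x = y.
Proof. by move=> /normr0_eq0/eqP; rewrite subr_eq0 => /eqP. Qed.

Lemma banach_distC x y : banach_dist x y = banach_dist y x.
Proof. exact: distrC. Qed.

Lemma banach_dist_triangle y x z :
  banach_dist x z <= banach_dist x y + banach_dist y z.
Proof. by rewrite /banach_dist -(subrKA (y : E)) ler_normD. Qed.

HB.instance Definition _ := Choice.on (banach_pm E).
HB.instance Definition _ := isPointed.Build (banach_pm E) (0 : E).
HB.instance Definition _ := isMetric.Build R (banach_pm E)
  banach_distxx banach_dist_eq0 banach_distC banach_dist_triangle.

End BanachPM.

Record pointedSubset (X : pointedMetricType R) := PointedSubset {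
  ps_set :> set X;
  ps_point : ps_set point }.

Record subpm (X : pointedMetricType R) (S : pointedSubset X) : Type :=
  SubPM { subpm_val : X; subpm_valP : subpm_val \in ps_set S }.

Section SubPMStructure.
Context (X : pointedMetricType R) (S : pointedSubset X).

HB.instance Definition _ := [isSub for @subpm_val X S].
HB.instance Definition _ := [Choice of subpm S by <:].

Definition subpm_dist (x y : subpm S) : R := mdist (subpm_val x) (subpm_val y).

Lemma subpm_distxx x : subpm_dist x x = 0.
Proof. exact: mdistxx. Qed.

Lemma subpm_dist_eq0 x y : subpm_dist x y = 0 -> x = y.
Proof. by move=> /mdist_positivity xy; exact: val_inj. Qed.

Lemma subpm_distC x y : subpm_dist x y = subpm_dist y x.
Proof. exact: metric_sym. Qed.

Lemma subpm_dist_triangle y x z : subpm_dist x z <= subpm_dist x y + subpm_dist y z.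
Proof. exact: metric_triangle. Qed.

HB.instance Definition _ := isPointed.Build (subpm S) (SubPM (mem_set (ps_point S))).
HB.instance Definition _ := isMetric.Build R (subpm S)
  subpm_distxx subpm_dist_eq0 subpm_distC subpm_dist_triangle.

End SubPMStructure.

Definition lip0 (X Y : pointedMetricType R) (f : X -> Y) : Prop :=
  f point = point /\
  exists2 C : R, 0 <= C & forall x y, mdist (f x) (f y) <= C * mdist x y.

Definition lip_const (X Y : pointedMetricType R) (f : X -> Y) : R :=
  inf [set C : R | 0 <= C /\ forall x y, mdist (f x) (f y) <= C * mdist x y].

Section Translation.
Context (E F : completeNormedModType R) (S : pointedSubset (banach_pm E)).
Context (x0 : subpm S).

Definition shift_set : set (banach_pm E) :=
  [set (x : E) - (subpm_val x0 : E) | x in ps_set S].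

Lemma shift_set_point : shift_set point.
Proof. by exists (subpm_val x0); [exact: set_mem (subpm_valP x0)|exact: subrr]. Qed.

Definition shift : pointedSubset (banach_pm E) := PointedSubset shift_set_point.

Lemma unshift_subproof (z : subpm shift) :
  ((subpm_val z : E) + (subpm_val x0 : E) : banach_pm E) \in ps_set S.
Proof.
by case: z => z /= /set_mem[x Sx <-]; rewrite subrK; exact: mem_set.
Qed.

Definition unshift (z : subpm shift) : subpm S := SubPM (unshift_subproof z).

Definition translate (f : subpm S -> F) (z : subpm shift) : F :=
  f (unshift z) - f x0.

End Translation.

Definition banach_component (V : lmodType R) (A : set V) (N : V -> R) : Prop :=
  [/\ A 0 /\ (forall a u v, A u -> A v -> A (a *: u + v)),
      forall u, A u -> 0 <= N u /\ (N u = 0 -> u = 0),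
      forall u v, A u -> A v -> N (u + v) <= N u + N v,
      forall a u, A u -> N (a *: u) = `|a| * N u
    & forall u : nat -> V, (forall n, A (u n)) ->
      (forall e, 0 < e -> exists n0 : nat,
         forall m n : nat, (n0 <= m)%N -> (n0 <= n)%N -> N (u m - u n) < e) ->
      exists2 l, A l & N (u n - l) @[n --> \oo] --> (0 : R)].

(* The value of the ideal norm outside the ideal is irrelevant. *)
Record banachOperatorIdeal := BanachOperatorIdeal {
  op_mem : forall E F : completeNormedModType R, set (E -> F);
  op_norm : forall E F : completeNormedModType R, (E -> F) -> R;
  op_bounded_linear : forall (E F : completeNormedModType R) (T : E -> F),
    op_mem T -> bounded_linear T;
  op_banach : forall E F, banach_component (@op_mem E F) (@op_norm E F);
  op_id : op_mem (@idfun R^o) /\ op_norm (@idfun R^o) = 1;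
  op_ideal : forall (G E F H : completeNormedModType R)
    (U : G -> E) (T : E -> F) (S : F -> H),
    bounded_linear U -> op_mem T -> bounded_linear S ->
    op_mem (S \o T \o U) /\
    op_norm (S \o T \o U) <= opnorm S * op_norm T * opnorm U }.

(* Extending the ideal norm by +oo outside the ideal, so that a supremum of
   such norms is finite only if all the maps involved are in the ideal. *)
Definition op_enorm (A : banachOperatorIdeal) (E F : completeNormedModType R)
    (T : E -> F) : \bar R :=
  if `[< op_mem A T >] then (op_norm A T)%:E else +oo%E.

(* Finite-dimensional subspaces are automatically closed, so that it is
   harmless to let G range over closed subspaces, which are the ones with a
   Banach space structure. *)
Definition op_max_norm (A : banachOperatorIdeal) (E F : completeNormedModType R)
    (T : E -> F) : \bar R :=
  ereal_sup [set z | exists (G : closedSubspace E) (M : closedSubspace F),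
    [/\ finite_dim (subsp G), finite_dim (quotsp M) &
        z = op_enorm A (quot_pi M \o T \o @subsp_val R E G)]].

Definition op_maximal (A : banachOperatorIdeal) : Prop :=
  forall (E F : completeNormedModType R) (T : E -> F), bounded_linear T ->
    (op_mem A T <-> (op_max_norm A T < +oo)%E) /\
    (op_mem A T -> (op_norm A T)%:E = op_max_norm A T).

Record banachLipIdeal := BanachLipIdeal {
  lip_mem : forall (X : pointedMetricType R) (E : completeNormedModType R),
    set (X -> E);
  lip_norm : forall (X : pointedMetricType R) (E : completeNormedModType R),
    (X -> E) -> R;
  lip_lip0 : forall (X : pointedMetricType R) (E : completeNormedModType R)
    (f : X -> E),
    lip_mem f -> lip0 (f : X -> banach_pm E);
  lip_banach : forall X E, banach_component (@lip_mem X E) (@lip_norm X E);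
  lip_const_le : forall (X : pointedMetricType R) (E : completeNormedModType R)
    (f : X -> E),
    lip_mem f -> lip_const (f : X -> banach_pm E) <= lip_norm f;
  lip_id : lip_mem (@idfun R^o : banach_pm R^o -> R^o) /\
           lip_norm (@idfun R^o : banach_pm R^o -> R^o) = 1;
  lip_ideal : forall (Y X : pointedMetricType R) (E F : completeNormedModType R)
    (g : Y -> X) (f : X -> E) (S : E -> F),
    lip0 g -> lip_mem f -> bounded_linear S ->
    lip_mem (S \o f \o g) /\
    lip_norm (S \o f \o g) <= lip_const g * lip_norm f * opnorm S }.

Definition lip_enorm (I : banachLipIdeal) (X : pointedMetricType R)
    (E : completeNormedModType R) (f : X -> E) : \bar R :=
  if `[< lip_mem I f >] then (lip_norm I f)%:E else +oo%E.

Definition lip_max_norm (I : banachLipIdeal) (X : pointedMetricType R)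
    (E : completeNormedModType R) (f : X -> E) : \bar R :=
  ereal_sup [set z | exists (X0 : pointedSubset X) (M : closedSubspace E),
    [/\ finite_set (ps_set X0), finite_dim (quotsp M) &
        z = lip_enorm I (quot_pi M \o f \o @subpm_val X X0)]].

Definition lip_maximal (I : banachLipIdeal) : Prop :=
  forall (X : pointedMetricType R) (E : completeNormedModType R) (f : X -> E),
    lip0 (f : X -> banach_pm E) ->
    (lip_mem I f <-> (lip_max_norm I f < +oo)%E) /\
    (lip_mem I f -> (lip_norm I f)%:E = lip_max_norm I f).

Definition translation_invariant (I : banachLipIdeal) : Prop :=
  forall (E F : completeNormedModType R) (S : pointedSubset (banach_pm E))
    (x0 : subpm S) (f : subpm S -> F),
    lip0 (f : subpm S -> banach_pm F) ->
    (lip_mem I f <-> lip_mem I (@translate E F S x0 f)) /\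
    (lip_mem I f -> lip_norm I f = lip_norm I (@translate E F S x0 f)).

(* The Lipschitz ideal I and the operator ideal A have the same linear
   operators, with the same norm. *)
Definition linear_part_eq (I : banachLipIdeal) (A : banachOperatorIdeal) : Prop :=
  forall (E F : completeNormedModType R) (T : E -> F),
    (op_mem A T <->
       bounded_linear T /\ lip_mem I (T : banach_pm E -> F)) /\
    (op_mem A T -> lip_norm I (T : banach_pm E -> F) = op_norm A T).

End PointedMetricSpaces.

(* Main.v *)
(** (3) => (1): averaging the increments of [f] with an invariant mean over [E0],
    then over [E], gives [S x w = M_y ((f (x + y) - f y) w)], which is additive and
    Lipschitz, hence linear, and extends [T].  It stays in the ideal with norm at
    most that of [f]: by maximality it is enough to look at finitely many points and
    at a finite-dimensional quotient [H] of [dual F]; for weak*-continuous maps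
    [dual F -> H] a functional attaining the norm commutes with the mean and
    translation invariance applies, and arbitrary maps [dual F -> H] reduce to those
    by a weak form of local reflexivity.

    (2) => (3): the Lipschitz maps whose linearization on the Lipschitz-free space
    has bounded [A]-norm on finite combinations of points form a maximal,
    translation invariant ideal.  Its linear part is [A] because, for a
    finite-dimensional domain, an invariant mean turns the Lipschitz functions of a
    norming functional into linear ones (a dual form of the Godefroy-Kalton lifting). *)

Require Import Defs.
From mathcomp Require Import all_boot all_order all_algebra.
From mathcomp Require Import finmap.
From mathcomp Require Import all_classical all_reals all_analysis.
From mathcomp Require Import ring lra.
Set Implicit Arguments.
Unset Strict Implicit.
Unset Printing Implicit Defensive.
Import Order.TTheory GRing.Theory Num.Theory.
Import numFieldNormedType.Exports.
Local Open Scope classical_set_scope.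
Local Open Scope ring_scope.

(** * Sublinear functionals *)

Section HahnBanach.
Context {R : realType} {V : lmodType R}.
Implicit Types (D : set V) (p q L : V -> R).

(** Means are available for scalar functions only, so [S x] is defined by its values on [F]; this is
    where the dual target enters. Hence the maps out of [dual F] that pass through a mean are the
    finite sums of evaluations at points of [F]. A general quotient of [dual F] is not of this kind,
    which is what calls for local reflexivity. The equation [f = T] holds on [E0] only, so a mean
    over [E] alone would not see it, while a mean over [E0] alone would not suffice for additivity
    on [E]; the composed mean does both. The Lipschitz-free space is never constructed: operators
    into it are represented by finite families of functionals and points. The duality arguments
    share one pattern: a functional attaining an ideal norm, prescribed on a cone of finite
    combinations, is extended to a sup-normed space by the Mazur-Orlicz theorem. Finite nets recover
    norms only up to a factor [1 - e], hence the constants [c / (1 - e)]. *)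

Definition submodule D : Prop :=
  D 0 /\ forall (a : R) u v, D u -> D v -> D (a *: u + v).

(** Relative to [D], because components of ideals and spaces of bounded functions are predicates on
    a function space, not types. *)
Definition linear_on D L : Prop :=
  forall (a : R) u v, D u -> D v -> L (a *: u + v) = a * L u + L v.

Definition sublinear_on D p : Prop :=
  (forall u v, D u -> D v -> p (u + v) <= p u + p v) /\
  (forall (a : R) u, 0 <= a -> D u -> p (a *: u) <= a * p u).

Lemma submoduleD D u v : submodule D -> D u -> D v -> D (u + v).
Proof. by move=> [_ sD] Du Dv; rewrite -[u]scale1r; exact: sD. Qed.

Lemma submoduleZ D (a : R) u : submodule D -> D u -> D (a *: u).
Proof. by move=> [D0 sD] Du; rewrite -[a *: u]addr0; exact: sD. Qed.

Lemma submoduleN D u : submodule D -> D u -> D (- u).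
Proof. by move=> sD Du; rewrite -scaleN1r; exact: submoduleZ. Qed.

Lemma submoduleB D u v : submodule D -> D u -> D v -> D (u - v).
Proof. by move=> sD Du Dv; apply: submoduleD => //; exact: submoduleN. Qed.

Lemma submodule_sum D (I : Type) (s : seq I) (P : pred I) (u : I -> V) :
  submodule D -> (forall i, P i -> D (u i)) -> D (\sum_(i <- s | P i) u i).
Proof.
by move=> sD Du; elim/big_rec: _ => [|i x Pi Dx];
  [exact: sD.1|exact: submoduleD (Du _ Pi) Dx].
Qed.

Lemma linear_on0 D L : submodule D -> linear_on D L -> L 0 = 0.
Proof.
move=> [D0 _] lL; have := lL 1 0 0 D0 D0.
by rewrite scaler0 addr0 mul1r => /eqP; rewrite eq_sym -subr_eq0 addrK => /eqP.
Qed.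

Lemma linear_onZ D L (a : R) u :
  submodule D -> linear_on D L -> D u -> L (a *: u) = a * L u.
Proof.
by move=> sD lL Du; rewrite -[a *: u]addr0 lL ?(linear_on0 sD) ?addr0//; exact: sD.1.
Qed.

Lemma linear_onD D L u v : linear_on D L -> D u -> D v -> L (u + v) = L u + L v.
Proof. by move=> lL Du Dv; rewrite -[u]scale1r lL// mul1r scale1r. Qed.

Lemma linear_onN D L u : submodule D -> linear_on D L -> D u -> L (- u) = - L u.
Proof. by move=> sD lL Du; rewrite -scaleN1r (linear_onZ _ sD)// mulN1r. Qed.

Lemma linear_on_sum D L (I : Type) (s : seq I) (P : pred I) (u : I -> V) :
  submodule D -> linear_on D L -> (forall i, P i -> D (u i)) ->
  L (\sum_(i <- s | P i) u i) = \sum_(i <- s | P i) L (u i).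
Proof.
move=> sD lL Du.
suff [] : L (\sum_(i <- s | P i) u i) = \sum_(i <- s | P i) L (u i) /\
    D (\sum_(i <- s | P i) u i) by [].
elim/big_rec2: _ => [|i x y Pi [xy Dy]].
  by rewrite (linear_on0 sD lL); split => //; exact: sD.1.
by split; [rewrite (linear_onD lL) ?xy//; exact: Du|
  exact: submoduleD (Du _ Pi) Dy].
Qed.

Lemma sublinear_on0 D p : submodule D -> sublinear_on D p -> p 0 = 0.
Proof.
move=> [D0 _] [pD pZ].
have := pD 0 0 D0 D0; have := pZ 0 0 (lexx _) D0.
by rewrite addr0 scale0r mul0r; lra.
Qed.

Lemma sublinear_onZ D p (a : R) u : submodule D -> sublinear_on D p ->
  0 <= a -> D u -> p (a *: u) = a * p u.
Proof.
move=> sD sp a0 Du; have [->|an0] := eqVneq a 0.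
  by rewrite mul0r scale0r (sublinear_on0 sD sp).
have {a0 an0} a0 : 0 < a by rewrite lt_neqAle eq_sym an0.
apply/eqP; rewrite eq_le sp.2 ?(ltW a0)//= -ler_pdivlMl//.
rewrite -{1}[u](scalerK (lt0r_neq0 a0)).
by apply: sp.2; rewrite ?invr_ge0 ?(ltW a0)//; exact: submoduleZ.
Qed.

Lemma sublinear_onN D p u : submodule D -> sublinear_on D p -> D u -> - p (- u) <= p u.
Proof.
move=> sD sp Du; have := sp.1 u (- u) Du (submoduleN sD Du).
by rewrite subrr (sublinear_on0 sD sp); lra.
Qed.

(* The infimum of [p (v + w) - r] over a cone of constraints [r <= L w]: any
   linear functional it dominates is below [p] and satisfies the constraints. *)
Lemma sublinear_constrain D p (K : V -> R -> Prop) :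
  submodule D -> sublinear_on D p ->
  K 0 0 -> (forall w r w' r', K w r -> K w' r' -> K (w + w') (r + r')) ->
  (forall (a : R) w r, 0 < a -> K w r -> K (a *: w) (a * r)) ->
  (forall w r, K w r -> D w /\ r <= p w) ->
  exists q, [/\ sublinear_on D q, forall u, D u -> q u <= p u &
                forall w r, K w r -> q (- w) <= - r].
Proof.
move=> sD sp K0 KD KZ Kp.
pose S v := [set p (v + w.1) - w.2 | w in [set w | K w.1 w.2]].
(* Subadditivity at [w = (v + w) - v] together with [r <= p w] keeps the infimum finite. *)
have Slb v : D v -> lbound (S v) (- p (- v)).
  move=> Dv _ [[w r] /= Kw <-]; have [Dw rw] := Kp _ _ Kw.
  have := sp.1 (v + w) (- v) (submoduleD sD Dv Dw) (submoduleN sD Dv).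
  by rewrite addrC addKr; lra.
have Sp v w r : D v -> K w r -> inf (S v) <= p (v + w) - r.
  by move=> Dv Kw; apply: ge_inf; [exists (- p (- v)); exact: Slb|exists (w, r)].
have pS v (c : R) : (forall w r, K w r -> c <= p (v + w) - r) -> c <= inf (S v).
  move=> cS; apply: lb_le_inf; first by exists (p (v + 0) - 0), (0, 0).
  by move=> _ [[w r] /= Kw <-]; exact: cS.
exists (fun v => inf (S v)); split; first split.
- move=> u v Du Dv.
  rewrite -lerBlDr; apply: (pS) => w r Kw.
  rewrite lerBlDl -lerBlDr; apply: pS => w' r' Kw'.
  have := Sp _ _ _ (submoduleD sD Du Dv) (KD _ _ _ _ Kw Kw').
  rewrite addrACA; have := sp.1 (u + w) (v + w').
  have [Dw _] := Kp _ _ Kw; have [Dw' _] := Kp _ _ Kw'.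
  by move=> /(_ (submoduleD sD Du Dw) (submoduleD sD Dv Dw')); lra.
- move=> a u a0 Du; have [->|an0] := eqVneq a 0.
    rewrite scale0r mul0r (le_trans (Sp 0 0 0 sD.1 K0))//.
    by rewrite addr0 subr0 (sublinear_on0 sD sp).
  have {a0 an0}a0 : 0 < a by rewrite lt_neqAle eq_sym an0.
  rewrite -ler_pdivrMl//; apply: pS => w r Kw; rewrite ler_pdivrMl//.
  apply: (le_trans (Sp _ _ _ (submoduleZ _ sD Du) (KZ _ _ _ a0 Kw))).
  rewrite -scalerDr mulrBr lerB//; apply: sp.2 (ltW a0) _.
  by apply: submoduleD => //; have [] := Kp _ _ Kw.
- by move=> u Du; have := Sp u 0 0 Du K0; rewrite addr0 subr0.
- move=> w r Kw; have [Dw _] := Kp _ _ Kw.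
  have := Sp (- w) w r (submoduleN sD Dw) Kw.
  by rewrite addNr (sublinear_on0 sD sp) sub0r.
Qed.

(** To bound the infimum at [u + v] by [q u + q' v], use subadditivity of the smaller of [q] and
    [q']. The common bound [p] keeps the infima finite. *)
Lemma chain_inf_sublinear D p (A : set (V -> R)) :
  submodule D -> A !=set0 ->
  (forall q, A q -> sublinear_on D q /\ forall u, D u -> q u <= p u) ->
  total_on A (fun q q' => forall u, D u -> q' u <= q u) ->
  sublinear_on D (fun u => inf [set q u | q in A]) /\
  forall u, D u -> forall q, A q -> inf [set q u | q in A] <= q u.
Proof.
move=> sD [q0 Aq0] Ap tA.
have leq u q : D u -> A q -> inf [set q u | q in A] <= q u.
  move=> Du Aq; apply: ge_inf; last by exists q.
  exists (- p (- u)) => _ [q' Aq' <-]; have [sq' q'p] := Ap _ Aq'.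
  have DNu := submoduleN sD Du.
  by have := sublinear_onN sD sq' Du; have := q'p _ DNu; lra.
have geq u (c : R) : (forall q, A q -> c <= q u) -> c <= inf [set q u | q in A].
  by move=> cA; apply: lb_le_inf; [exists (q0 u), q0|move=> _ [q Aq <-]; exact: cA].
split; last by move=> u Du q; exact: leq.
split=> [u v Du Dv|a u a0 Du].
  rewrite -lerBlDr; apply: (geq) => q Aq; rewrite lerBlDl -lerBlDr; apply: geq => q' Aq'.
  have Duv := submoduleD sD Du Dv.
  have [qq'|q'q] := tA _ _ Aq Aq'.
    have := (Ap _ Aq').1.1 _ _ Du Dv; have := qq' _ Du.
    by have := leq _ _ Duv Aq'; lra.
  have := (Ap _ Aq).1.1 _ _ Du Dv; have := q'q _ Dv.
  by have := leq _ _ Duv Aq; lra.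
have [->|an0] := eqVneq a 0.
  rewrite scale0r mul0r (le_trans (leq _ _ sD.1 Aq0))//.
  by rewrite (sublinear_on0 sD (Ap _ Aq0).1).
have {}a0 : 0 < a by rewrite lt_neqAle eq_sym an0.
rewrite -ler_pdivrMl//; apply: (geq) => q Aq; rewrite ler_pdivrMl//.
apply: (le_trans (leq _ _ (submoduleZ _ sD Du) Aq)).
by apply: (Ap _ Aq).1.2 => //; exact: ltW.
Qed.

(** A minimal sublinear functional is linear: constraining it along the ray through [x] yields a
    smaller one whose value at [- x] is at most [- q x], and minimality gives [q (- x) = - q x].
    Zorn's lemma is applied to the reversed pointwise order. *)
Lemma sublinear_linear_minorant D p :
  submodule D -> sublinear_on D p ->
  exists L, linear_on D L /\ forall u, D u -> L u <= p u.
Proof.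
move=> sD sp.
pose T := {q | sublinear_on D q /\ forall u, D u -> q u <= p u}.
pose below (q q' : T) := `[< forall u, D u -> sval q' u <= sval q u >].
have p_below : sublinear_on D p /\ forall u, D u -> p u <= p u by [].
have [|||[q [sq qp]] qmax] := @ZL_preorder T (exist _ p p_below) below.
- by move=> q; apply/asboolP.
- move=> r s t /asboolP rs /asboolP st; apply/asboolP => u Du.
  exact: le_trans (st _ Du) (rs _ Du).
- move=> A tA; have [A0|/set0P/negP/negPn/eqP A0] := pselect (A !=set0); last first.
    by exists (exist _ p p_below) => s; rewrite A0.
  have [|||sq qle] := @chain_inf_sublinear D p [set sval q | q in A] sD.
  + by have [q Aq] := A0; exists (sval q), q.
  + by move=> _ [[q qP] _ <-].
  + move=> _ _ [q Aq <-] [q' Aq' <-].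
    by have [/asboolP|/asboolP] := tA _ _ Aq Aq'; [left|right].
  have qp u : D u -> inf [set q u | q in [set sval q | q in A]] <= p u.
    move=> Du; have [q Aq] := A0.
    by apply: (le_trans (qle u Du (sval q) _)); [exists q|exact: (svalP q).2].
  exists (exist (fun q => sublinear_on D q /\ forall u, D u -> q u <= p u)
            _ (conj sq qp)).
  by move=> q Aq; apply/asboolP => u Du /=; apply: qle => //; exists q.
have qN x : D x -> q (- x) = - q x.
  move=> Dx.
  pose K w r := exists2 t : R, 0 <= t & w = t *: x /\ r = t * q x.
  have [||||q' [sq' q'q q'K]] := @sublinear_constrain D q K sD sq.
  + by exists 0 => //; rewrite scale0r mul0r.
  + move=> _ _ _ _ [t t0 [-> ->]] [t' t'0 [-> ->]].
    by exists (t + t'); rewrite ?addr_ge0// scalerDl mulrDl.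
  + move=> a _ _ a0 [t t0 [-> ->]]; exists (a * t); first by rewrite mulr_ge0// ltW.
    by rewrite scalerA mulrA.
  + move=> _ _ [t t0 [-> ->]]; split; first exact: submoduleZ.
    by rewrite (sublinear_onZ sD sq).
  have q'p u : D u -> q' u <= p u.
    by move=> Du; apply: le_trans (q'q _ Du) (qp _ Du).
  have /asboolP := qmax (exist _ q' (conj sq' q'p)) (asboolT q'q).
  move=> /(_ (- x) (submoduleN sD Dx)) /=.
  have : q' (- x) <= - q x by apply: q'K; exists 1; rewrite // scale1r mul1r.
  by have := sublinear_onN sD sq Dx; lra.
exists q; split => // a u v Du Dv.
have qD x y : D x -> D y -> q (x + y) = q x + q y.
  move=> Dx Dy; have := sq.1 _ _ Dx Dy.
  have := sq.1 _ _ (submoduleD sD Dx Dy) (submoduleN sD Dy).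
  by rewrite addrK qN//; lra.
have qZ b x : 0 <= b -> D x -> q (b *: x) = b * q x.
  move=> b0 Dx; have := sq.2 b x b0 Dx; have := sq.2 b _ b0 (submoduleN sD Dx).
  by rewrite scalerN !qN//; [lra|exact: submoduleZ].
rewrite qD//; last exact: submoduleZ.
congr (_ + _); have [a0|a0] := leP 0 a; first exact: qZ.
rewrite -[a]opprK scaleNr qN; last exact: submoduleZ.
by rewrite qZ ?mulNr//; lra.
Qed.

(** If the cone [K] is stable under negation, the constraints become equalities and [L] extends the
    values prescribed by [K]. That two values prescribed at the same [w] agree then follows from
    [r <= p w] and needs no preliminary check. *)
Lemma mazur_orlicz D p (K : V -> R -> Prop) :
  submodule D -> sublinear_on D p ->
  K 0 0 -> (forall w r w' r', K w r -> K w' r' -> K (w + w') (r + r')) ->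
  (forall (a : R) w r, 0 < a -> K w r -> K (a *: w) (a * r)) ->
  (forall w r, K w r -> D w /\ r <= p w) ->
  exists L, [/\ linear_on D L, forall u, D u -> L u <= p u &
                forall w r, K w r -> r <= L w].
Proof.
move=> sD sp K0 KD KZ Kp.
have [q [sq qp qK]] := sublinear_constrain sD sp K0 KD KZ Kp.
have [L [lL Lq]] := sublinear_linear_minorant sD sq.
exists L; split=> // [u Du|w r Kw]; first exact: le_trans (Lq _ Du) (qp _ Du).
have [Dw _] := Kp _ _ Kw; have := Lq _ (submoduleN sD Dw).
by rewrite (linear_onN sD lL)//; have := qK _ _ Kw; lra.
Qed.

Lemma hahn_banach_attained D p x :
  submodule D -> sublinear_on D p -> D x ->
  exists L, [/\ linear_on D L, forall u, D u -> L u <= p u & L x = p x].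
Proof.
move=> sD sp Dx.
have [||||L [lL Lp Lx]] :=
  @mazur_orlicz D p (fun w r => exists2 t : R, 0 <= t & w = t *: x /\ r = t * p x) sD sp.
- by exists 0 => //; rewrite scale0r mul0r.
- move=> _ _ _ _ [t t0 [-> ->]] [t' t'0 [-> ->]].
  by exists (t + t'); rewrite ?addr_ge0// scalerDl mulrDl.
- move=> a _ _ a0 [t t0 [-> ->]]; exists (a * t); first by rewrite mulr_ge0// ltW.
  by rewrite scalerA mulrA.
- move=> _ _ [t t0 [-> ->]]; split; first exact: submoduleZ.
  by rewrite (sublinear_onZ sD sp).
exists L; split => //; apply/eqP; rewrite eq_le Lp//=.
by apply: Lx; exists 1; rewrite ?scale1r ?mul1r.
Qed.

End HahnBanach.

(** * Invariant means *)

Section NormedSpaces.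
Context {R : realType}.

Lemma norming_functional (V : normedModType R) (x : V) :
  exists f : V -> R^o,
    [/\ bounded_linear f, f x = `|x| & forall y, `|f y| <= `|y|].
Proof.
have sT : submodule (setT : set V) by [].
have sp : sublinear_on setT (fun y : V => `|y|).
  by split=> [u v _ _|a u a0 _]; [exact: ler_normD|rewrite normrZ ger0_norm].
have [L [lL Lp Lx]] := hahn_banach_attained sT sp (I : setT x).
have Ly y : `|L y| <= `|y|.
  rewrite ler_norml Lp// andbT lerNl -(linear_onN sT lL)//.
  by rewrite -[leRHS]normrN Lp.
exists L; split=> //; split; first by move=> a u v; rewrite lL.
by exists 1 => y; rewrite mul1r.
Qed.

Lemma le0_of_le_divn (x c : R) : 0 <= c ->
  (forall n : nat, x * n.+1%:R <= c) -> x <= 0.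
Proof.
move=> c0 xc; rewrite leNgt; apply/negP => x0.
have := xc (Num.truncn (c / x)); rewrite leNgt => /negP; apply.
by rewrite mulrC -ltr_pdivrMr// truncnS_gt.
Qed.

(** Removes the factor lost to an approximate net. *)
Lemma le_of_le_mul1B (x c : R) : 0 <= c ->
  (forall e, 0 < e -> e < 1 -> (1 - e) * x <= c) -> x <= c.
Proof.
move=> c0 xc; rewrite leNgt; apply/negP => cx.
have x0 : 0 < x := le_lt_trans c0 cx.
have cx1 : c / x < 1 by rewrite ltr_pdivrMr// mul1r.
have cx0 : 0 <= c / x by rewrite divr_ge0// ltW.
(* For this [e], [1 - e] is the midpoint of [c / x] and [1]. *)
by have := xc ((1 - c / x) / 2); rewrite -ler_pdivlMr//; lra.
Qed.

(** The defect [h b] of homogeneity at [x] is additive in [b] and vanishes at the naturals, so on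
    [b >= 0] it is bounded by its values at fractional parts; being additive and bounded there, it
    is zero. *)
Lemma additive_bounded_linear (V W : normedModType R) (g : V -> W) (C : R) :
  (forall x y, g (x + y) = g x + g y) -> (forall x, `|g x| <= C * `|x|) -> linear g.
Proof.
move=> gD gC.
have g0 : g 0 = 0.
  by have := gD 0 0; rewrite addr0 => /(congr1 (fun v => v - g 0)); rewrite addrK subrr.
have gN x : g (- x) = - g x by apply/eqP; rewrite -addr_eq0 -gD addNr g0.
suff gZ a x : g (a *: x) = a *: g x by move=> a x y; rewrite gD gZ.
pose h b := g (b *: x) - b *: g x.
have hD b c : h (b + c) = h b + h c by rewrite /h !scalerDl gD opprD addrACA.
have hn n : h n%:R = 0.
  elim: n => [|n IH]; first by rewrite /h !scale0r g0 subr0.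
  by rewrite -addn1 natrD hD IH add0r /h !scale1r subrr.
have hb b : `|h b| <= `|b| * (C * `|x| + `|g x|).
  rewrite (le_trans (ler_normB _ _))// mulrDr normrZ lerD2r (le_trans (gC _))//.
  by rewrite normrZ mulrCA.
have C0 : 0 <= C * `|x| + `|g x| by have := hb 1; rewrite normr1 mul1r; apply: le_trans.
have hbd b : 0 <= b -> `|h b| <= C * `|x| + `|g x|.
  move=> b0; have /andP[nb bn] := truncn_itv b0.
  rewrite -[b](subrK (Num.truncn b)%:R) hD hn addr0 (le_trans (hb _))// ler_piMl//.
  by rewrite ger0_norm ?subr_ge0// lerBlDl natr1 ltW.
have hnb n b : h (b * n%:R) = h b *+ n.
  elim: n => [|n IH]; first by rewrite mulr0 mulr0n -[0]/(0%:R) hn.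
  by rewrite -addn1 natrD mulrDr hD IH mulr1 mulrnDr mulr1n.
have h0 b : 0 <= b -> h b = 0.
  move=> b0; apply/normr0_eq0/eqP; rewrite eq_le normr_ge0 andbT.
  apply: (le0_of_le_divn C0) => n; rewrite mulr_natr -normrMn -hnb hbd//.
  by rewrite mulr_ge0.
suff : h a = 0 by move/eqP; rewrite subr_eq0 => /eqP.
have [/h0//|a0] := leP 0 a.
have hN b : h (- b) = - h b by rewrite /h !scaleNr gN opprB opprK addrC.
by rewrite -[a]opprK hN h0 ?oppr0// oppr_ge0 ltW.
Qed.

End NormedSpaces.

Lemma sumr_const_seq (V : nmodType) (I : Type) (s : seq I) (x : V) :
  \sum_(i <- s) x = x *+ size s.
Proof. by rewrite big_const_seq count_predT iter_addr_0. Qed.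

Section Means.
Context {R : realType}.

Definition bdd (G : Type) : set (G -> R^o) :=
  [set g | exists M : R, forall x, `|g x| <= M].

Lemma submodule_bdd (G : Type) : submodule (@bdd G).
Proof.
split; first by exists 0 => x; rewrite normr0.
move=> a u v [M uM] [N vN]; exists (`|a| * M + N) => x.
by rewrite (le_trans (ler_normD _ _))// lerD// normrZ ler_wpM2l.
Qed.

Lemma bdd_sum (G I : Type) (s : seq I) (g : I -> G -> R^o) :
  (forall i, bdd (g i)) -> bdd (fun x => \sum_(i <- s) g i x).
Proof.
move=> bg; have -> : (fun x => \sum_(i <- s) g i x) = \sum_(i <- s) g i.
  by apply/funext => x; rewrite fct_sumE.
by apply: submodule_sum => //; exact: submodule_bdd.
Qed.

Lemma bddZ (G : Type) (a : R) (g : G -> R^o) : bdd g -> bdd (fun x => a * g x : R^o).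
Proof. exact: submoduleZ (submodule_bdd G). Qed.

Lemma bddB (G : Type) (g h : G -> R^o) :
  bdd g -> bdd h -> bdd (fun x => g x - h x : R^o).
Proof. exact: submoduleB (submodule_bdd G). Qed.

(** [mean_le] combines positivity and normalization. Outside the bounded functions the values of [L]
    are arbitrary. *)
Record mean (G : Type) (L : (G -> R^o) -> R) : Prop := Mean {
  mean_linear : linear_on (@bdd G) L;
  mean_le : forall g (M : R), bdd g -> (forall x, g x <= M) -> L g <= M }.

Section MeanTheory.
Context (G : Type) (L : (G -> R^o) -> R) (mL : mean L).

Lemma mean_ge g (M : R) : bdd g -> (forall x, M <= g x) -> M <= L g.
Proof.
move=> bg Mg; rewrite -lerN2 -(linear_onN (submodule_bdd G) (mean_linear mL))//.
apply: mean_le => //; first exact: submoduleN (submodule_bdd G) bg.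
by move=> x; rewrite lerN2.
Qed.

Lemma bdd_cst (c : R) : bdd (fun _ : G => c : R^o).
Proof. by exists `|c|. Qed.

Lemma mean_cst (c : R) : L (fun=> c) = c.
Proof.
by apply/eqP; rewrite eq_le mean_le ?mean_ge//; exact: bdd_cst.
Qed.

Lemma mean_norm g (M : R) : (forall x, `|g x| <= M) -> `|L g| <= M.
Proof.
move=> gM; have bg : bdd g by exists M.
rewrite ler_norml mean_ge// ?mean_le// => x; have := gM x.
  by rewrite ler_norml => /andP[].
by rewrite ler_norml => /andP[].
Qed.

Lemma meanD g h : bdd g -> bdd h -> L (fun x => g x + h x) = L g + L h.
Proof. exact: linear_onD (mean_linear mL). Qed.

Lemma meanB g h : bdd g -> bdd h -> L (fun x => g x - h x) = L g - L h.
Proof.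
move=> bg bh; have sb := submodule_bdd G.
rewrite -(linear_onN sb (mean_linear mL) bh).
exact: linear_onD (mean_linear mL) bg (submoduleN sb bh).
Qed.

Lemma meanZ (a : R) g : bdd g -> L (fun x => a * g x) = a * L g.
Proof. exact: linear_onZ (submodule_bdd G) (mean_linear mL). Qed.

Lemma mean_sum (I : Type) (s : seq I) (g : I -> G -> R^o) :
  (forall i, bdd (g i)) -> L (fun x => \sum_(i <- s) g i x) = \sum_(i <- s) L (g i).
Proof.
move=> bg; rewrite -(linear_on_sum _ (submodule_bdd G) (mean_linear mL))//.
by congr L; apply/funext => x; rewrite fct_sumE.
Qed.

End MeanTheory.

(** * Amenability of abelian groups *)

Section InvariantMean.
Context (G : zmodType).

(** The infimum of this set, an infimum over [ys] of suprema over [z] of averages, is the sublinear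
    functional of the classical proof that abelian groups are amenable. *)
Let avgs (g : G -> R^o) : set R := [set M | exists2 ys : seq G,
  ys != [::] & forall z, \sum_(y <- ys) g (z + y) <= M * (size ys)%:R].

Let avgs_lb g B : (forall x, `|g x| <= B) -> lbound (avgs g) (- B).
Proof.
move=> gB M [ys ys0 /(_ 0) gM].
have sy : 0 < (size ys)%:R :> R by rewrite ltr0n lt0n size_eq0.
rewrite -(ler_pM2r sy); apply: le_trans gM.
rewrite mulr_natr -sumr_const_seq; apply: ler_sum => y _.
by rewrite lerNl (le_trans _ (gB (0 + y)))// -normrN ler_norm.
Qed.

Let avgs_cst g B : (forall x, g x <= B) -> avgs g B.
Proof. by move=> gB; exists [:: 0] => // z; rewrite big_seq1 mulr1. Qed.

Let avgs_sublinear : sublinear_on (@bdd G) (fun g => inf (avgs g)).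
Proof.
have ne g : bdd g -> avgs g !=set0.
  by move=> [B gB]; exists B; apply: avgs_cst => x; exact: le_trans (ler_norm _) (gB x).
have lb g : bdd g -> has_lbound (avgs g).
  by move=> [B gB]; exists (- B); exact: avgs_lb.
split=> [g h bg bh|a g a0 bg].
  rewrite -lerBlDr; apply: lb_le_inf; first exact: ne.
  move=> M [ys ys0 gM]; rewrite lerBlDl -lerBlDr; apply: lb_le_inf; first exact: ne.
  move=> N [zs zs0 hN]; rewrite lerBlDr; apply: ge_inf.
    by apply: lb; exact: submoduleD (submodule_bdd G) bg bh.
  (* The sumset serves both functions: grouped by [z] it averages [g] over [ys], grouped by [y] it
     averages [h] over [zs]. Commutativity allows both groupings. *)
  exists [seq y + z | y <- ys, z <- zs].
    by move: ys0 zs0; case: (ys) => //= y ys' _; case: (zs).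
  move=> x; rewrite size_allpairs big_allpairs_dep/=.
  have -> : \sum_(y <- ys) \sum_(z <- zs) (g + h) (x + (y + z)) =
      \sum_(z <- zs) \sum_(y <- ys) g ((x + z) + y) +
      \sum_(y <- ys) \sum_(z <- zs) h ((x + y) + z).
    rewrite exchange_big/= [X in _ = _ + X]exchange_big/= -big_split/=.
    apply: eq_bigr => z _; rewrite -big_split/=; apply: eq_bigr => y _.
    by rewrite -!addrA [z + y]addrC.
  rewrite mulrDl natrM addrC lerD//.
    rewrite mulrCA [leRHS]mulrC mulr_natr -sumr_const_seq.
    by apply: ler_sum => y _; exact: hN.
  rewrite mulrA mulr_natr -sumr_const_seq.
  by apply: ler_sum => z _; exact: gM.
have [->|an0] := eqVneq a 0.
  rewrite scale0r mul0r; apply: ge_inf; last exact: avgs_cst.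
  by apply: lb; exact: (submodule_bdd G).1.
have {an0}a0' : 0 < a by rewrite lt_neqAle eq_sym an0.
rewrite -ler_pdivrMl//; apply: lb_le_inf; first exact: ne.
move=> M [ys ys0 gM]; rewrite ler_pdivrMl//; apply: ge_inf.
  by apply: lb; exact: submoduleZ (submodule_bdd G) bg.
exists ys => // z; rewrite -mulrA -[leLHS]/(\sum_(y <- ys) a * g (z + y)).
by rewrite -mulr_sumr ler_wpM2l.
Qed.

Lemma invariant_mean : exists L : (G -> R^o) -> R,
  mean L /\ forall g t, bdd g -> L (fun x => g (x + t)) = L g.
Proof.
have sb := submodule_bdd G.
have [L [lL Lp]] := sublinear_linear_minorant sb avgs_sublinear.
have lb g : bdd g -> has_lbound (avgs g).
  by move=> [B gB]; exists (- B); exact: avgs_lb.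
exists L; split.
  split=> // g M bg gM; apply: (le_trans (Lp _ bg)); apply: ge_inf; first exact: lb.
  exact: avgs_cst.
have Lt g t : bdd g -> L (fun x => g (x + t)) <= L g.
  move=> bg; have [B gB] := bg; have B0 : 0 <= B := le_trans (normr_ge0 _) (gB 0).
  have bgt : bdd (fun x => g (x + t)) by exists B.
  have bd := submoduleB sb bgt bg.
  have -> : L (fun x => g (x + t)) = L g + L ((fun x => g (x + t)) - g).
    by rewrite -(linear_onD lL)// addrC subrK.
  rewrite gerDl (le_trans (Lp _ bd))//.
  apply: (@le0_of_le_divn _ _ (B + B)); first by rewrite addr_ge0.
  move=> n; rewrite -ler_pdivlMr//; apply: ge_inf; first exact: lb.
  (* Along these multiples of [t] the differences telescope, so their sum is at most [B + B]
     whatever [n] is. *)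
  exists [seq t *+ i | i <- iota 0 n.+1]; first by [].
  move=> z; rewrite size_map size_iota divfK// big_map.
  have -> : \sum_(i <- iota 0 n.+1) ((fun x => g (x + t)) - g) (z + t *+ i) =
      \sum_(0 <= i < n.+1) (g (z + t *+ i.+1) - g (z + t *+ i)).
    apply: eq_bigr => i _; rewrite mulrS [t + _]addrC addrA.
    by [].
  rewrite telescope_sumr// (le_trans (ler_norm _))// (le_trans (ler_normB _ _))//.
  exact: lerD.
move=> g t bg; apply/eqP; rewrite eq_le Lt//=.
have [B gB] := bg.
have /(Lt _ (- t)) : bdd (fun x => g (x + t)) by exists B.
by congr (_ <= _); congr L; apply/funext => x; rewrite subrK.
Qed.

End InvariantMean.
End Means.

(** * Finite-dimensional spaces *)

Section FiniteDim.
Context {R : realType}.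

Lemma finite_dim_basis (V : lmodType R) : finite_dim V ->
  exists (n : nat) (b : 'I_n -> V),
    (forall v, exists c : 'I_n -> R, v = \sum_i c i *: b i) /\
    (forall t : 'I_n -> R, \sum_i t i *: b i = 0 -> t =1 fun=> 0).
Proof.
move=> fV.
pose P n := `[< exists b : 'I_n -> V, forall v, exists c, v = \sum_i c i *: b i >].
have exP : exists n, P n by have [n [b bV]] := fV; exists n; apply/asboolP; exists b.
case: (ex_minnP exP) => n /asboolP[b bV] nmin.
exists n, b; split=> // t t0 j; apply/eqP/negPn/negP => tj.
case: n => [|n] in b bV nmin t t0 j tj *; first by case: j tj.
suff /nmin : P n by rewrite ltnn.
apply/asboolP; exists (b \o lift j) => v; have [c ->] := bV v.
exists (fun i => c (lift j i) - c j * (t j)^-1 * t (lift j i)).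
have bj : b j = - ((t j)^-1 *: \sum_i t (lift j i) *: b (lift j i)).
  move: t0; rewrite (bigD1_ord j)//= => /eqP; rewrite addr_eq0 => /eqP tb.
  by rewrite -scalerN -tb scalerA mulVf// scale1r.
rewrite (bigD1_ord j)//= {1}bj scalerN scalerA scaler_sumr addrC -sumrB.
by apply: eq_bigr => i _; rewrite scalerA scalerBl.
Qed.

Section Coordinates.
Context (V : normedModType R) (n : nat) (b : 'I_n -> V).

Let comb (a : 'rV[R]_n) : V := \sum_i a ord0 i *: b i.

Let comb_continuous : continuous comb.
Proof.
apply: continuous_big => [|i _ a]; first exact: add_continuous.
by have /cvgZr_tmp := @coord_continuous R _ _ ord0 i a; exact.
Qed.

Let normr_comb_continuous : continuous (fun a => `|comb a|).
Proof.
by move=> a; apply: (@continuous_comp _ _ _ comb);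
  [exact: comb_continuous|exact: norm_continuous].
Qed.

(** The norm of a combination is continuous in its coefficients and, by freeness, positive on the
    compact unit sphere of coefficient rows; [C] is the inverse of its minimum there. *)
Lemma bounded_coordinates : (forall t : 'I_n -> R, \sum_i t i *: b i = 0 -> t =1 fun=> 0) ->
  exists2 C : R, 0 <= C & forall (t : 'I_n -> R) i, `|t i| <= C * `|\sum_i t i *: b i|.
Proof.
move=> free.
pose A := [set a : 'rV[R]_n | `|a| = 1].
have cA : compact A.
  apply: bounded_closed_compact.
    by exists 1; split; [exact: num_real|move=> M M1 a /= ->; exact: ltW].
  rewrite (_ : A = (fun a : 'rV[R]_n => `|a|) @^-1` [set 1]); last by apply/seteqP; split.
  by apply: closed_comp => //; move=> a _; exact: norm_continuous.
have rowE (t : 'I_n -> R) : comb (\row_i t i) = \sum_i t i *: b i.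
  by apply: eq_bigr => i _; rewrite mxE.
have [A0|A0] := pselect (A !=set0); last first.
  exists 0 => // t i; rewrite mul0r normr_le0; apply/eqP.
  have : (\row_i t i : 'rV[R]_n) = 0.
    apply/eqP/negPn/negP => t0; apply: A0.
    exists (`|\row_i t i|^-1 *: \row_i t i).
    by rewrite /A/= normrZ normfV normr_id mulVf// normr_eq0.
  by move=> /matrixP/(_ ord0 i); rewrite !mxE.
have [a /set_mem Aa amin] :=
  EVT_min_rV A0 cA (continuous_subspaceT normr_comb_continuous).
have comba : 0 < `|comb a|.
  rewrite normr_gt0; apply/negP => /eqP /free a0.
  have : a = 0 by apply/rowP => i; rewrite mxE a0.
  by move=> a00; move: Aa; rewrite /A/= a00 normr0 => /eqP; rewrite eq_sym oner_eq0.
exists (`|comb a|^-1); first by rewrite invr_ge0.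
move=> t i; rewrite -rowE; set r := \row_i t i.
rewrite -[t i]/(t i) ler_pdivlMl//.
have -> : t i = r ord0 i by rewrite mxE.
have ri : `|r ord0 i| <= `|r|.
  by rewrite [leRHS]/Num.Def.normr/= mx_normrE; apply/bigmax_geP; right => /=;
    exists (ord0, i).
have [r0|r0] := eqVneq r 0.
  by rewrite r0 mxE normr0 mulr0.
have nr : 0 < `|r| by rewrite normr_gt0.
have /amin : `|r|^-1 *: r \in A.
  by apply/mem_set; rewrite /A/= normrZ normfV normr_id mulVf// gt_eqF.
have -> : comb (`|r|^-1 *: r) = `|r|^-1 *: comb r.
  by rewrite /comb scaler_sumr; apply: eq_bigr => k _; rewrite mxE scalerA.
rewrite normrZ normfV normr_id ler_pdivlMl//; apply: le_trans.
by rewrite mulrC ler_wpM2r.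
Qed.

(** Bounded coordinates make the coefficients of the unit ball a compact set; the net consists of
    the centres of a finite subcover, themselves in the unit ball. *)
Lemma precompact_ball (e : R) : 0 < e ->
  (forall t : 'I_n -> R, \sum_i t i *: b i = 0 -> t =1 fun=> 0) ->
  exists m (z : 'I_m -> V), (forall j, `|z j| <= 1) /\
    forall t : 'I_n -> R, `|\sum_i t i *: b i| <= 1 ->
      exists j, `|\sum_i t i *: b i - z j| <= e.
Proof.
move=> e0 /bounded_coordinates[C C0 bC].
pose A := [set a : 'rV[R]_n | `|comb a| <= 1].
have cA : compact A.
  apply: bounded_closed_compact.
    exists C; split; [exact: num_real|move=> M CM a /= Aa].
    rewrite (le_trans _ (ltW CM))// [leLHS]/Num.Def.normr/= mx_normrE.
    rewrite (bigmax_le _ C0)//= => -[i j] _.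
    by rewrite ord1 (le_trans (bC (fun i => a ord0 i) j))// ler_piMr.
  rewrite (_ : A = (fun a => `|comb a|) @^-1` [set x | x <= 1]); last by apply/seteqP; split.
  by apply: closed_comp => // a _; exact: normr_comb_continuous.
move: cA; rewrite compact_cover => /(_ _ A (fun a => comb @^-1` ball (comb a) e))[].
- by move=> a _; apply: open_comp => [x _|]; [exact: comb_continuous|exact: ball_open].
- by move=> a Aa; exists a => //; exact: ballxx.
move=> D DA Dcov.
exists (size (enum_fset D)), (fun j => comb (nth 0 (enum_fset D) j)); split=> [j|t t1].
  by have /DA /set_mem : nth 0 (enum_fset D) j \in D by exact: mem_nth.
have rowE : comb (\row_i t i) = \sum_i t i *: b i.
  by apply: eq_bigr => i _; rewrite mxE.
have [|a /= Da] := Dcov (\row_i t i); first by rewrite /A/= rowE.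
rewrite -ball_normE/= rowE => at1.
have ia : (index a (enum_fset D) < size (enum_fset D))%N by rewrite index_mem.
by exists (Ordinal ia); rewrite /= nth_index// distrC ltW.
Qed.

End Coordinates.

Lemma finite_dim_coordinates (V : normedModType R) : finite_dim V ->
  exists (n : nat) (b : 'I_n -> V) (c : 'I_n -> V -> R^o),
    (forall i, bounded_linear (c i)) /\ forall v, v = \sum_i c i v *: b i.
Proof.
move=> /finite_dim_basis[n [b [/choice[c cV] free]]].
have cb t : c (\sum_i t i *: b i) =1 t.
  move=> i; apply/eqP; rewrite -subr_eq0; apply/eqP.
  apply: (free (fun i => c (\sum_i t i *: b i) i - t i)).
  by under eq_bigr do rewrite scalerBl; rewrite sumrB -cV subrr.
have [C C0 bC] := bounded_coordinates free.
exists n, b, (fun i v => c v i); split=> // i; split=> [a u v|].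
  rewrite {1}(cV u) {1}(cV v) scaler_sumr -big_split/=.
  under [X in c X]eq_bigr do rewrite scalerA -scalerDl.
  by rewrite cb.
by exists C => v; rewrite {2}(cV v).
Qed.

Lemma finite_dim_norming_points (V : normedModType R) (e : R) : finite_dim V -> 0 < e ->
  exists m (z : 'I_m -> V),
    [/\ forall j, `|z j| <= 1, forall v, `|v| <= 1 -> exists j, `|v - z j| <= e &
    forall (l : V -> R^o) (B : R), bounded_linear l -> (forall j, `|l (z j)| <= B) ->
      (1 - e) * opnorm l <= B].
Proof.
move=> /finite_dim_basis[n [b [bV free]]] e0.
have [m [z [z1 zV]]] := precompact_ball e0 free.
have net v : `|v| <= 1 -> exists j, `|v - z j| <= e by have [c ->] := bV v => /zV.
exists m, z; split=> // l B bl lB.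
(* On the unit ball, [|l v| <= |l (z j)| + |l (v - z j)| <= B + e * opnorm l]. *)
rewrite mulrBl mul1r lerBlDr; apply: ge_sup; first by have [] := opnorm_has_sup bl.
move=> _ [v /= /net[j vj] <-].
have -> : l v = l (z j) + l (v - z j).
  have := bl.1 1 (v - z j) (z j); rewrite !scale1r subrK => ->.
  by rewrite addrC.
rewrite (le_trans (ler_normD _ _))// lerD// (le_trans (opnorm_le _ bl))//.
by rewrite mulrC ler_wpM2r// opnorm_ge0.
Qed.

(** The functionals norm the points of an [e / 2]-net. On a unit vector [u], half of the loss comes
    from [|z j| >= 1 - e / 2] and half from [f j (u - z j)]. *)
Lemma finite_dim_norming_functionals (V : normedModType R) (e : R) :
  finite_dim V -> 0 < e ->
  exists m (f : 'I_m -> V -> R^o),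
    [/\ forall j, bounded_linear (f j), forall j v, `|f j v| <= `|v| &
        forall v (B : R), (forall j, `|f j v| <= B) -> (1 - e) * `|v| <= B].
Proof.
move=> fV e0; have e20 : 0 < e / 2 by rewrite divr_gt0.
have [m [z [_ zV _]]] := finite_dim_norming_points fV e20.
have /choice[f fP] j := norming_functional (z j).
exists m, f; split=> [j|j v|v B fB]; try by have [] := fP j.
(* At [v = 0] the claim is [0 <= B], which needs an index [j]; the net provides one. *)
have [->|v0] := eqVneq v 0.
  have [|j _] := zV 0; first by rewrite normr0.
  by rewrite normr0 mulr0 (le_trans _ (fB j)).
have nv : 0 < `|v| by rewrite normr_gt0.
have [|j] := zV (`|v|^-1 *: v); first by rewrite normrZ normfV normr_id mulVf ?gt_eqF.
have [bf fz f1] := fP j; set u := _ *: _ => uz.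
have nu : `|u| = 1 by rewrite normrZ normfV normr_id mulVf ?gt_eqF.
have fu : f j v = `|v| * f j u.
  by rewrite -[RHS]linear_funZ; [rewrite scalerA divff ?scale1r ?gt_eqF|exact: bf.1].
have : `|v| * (1 - e) <= `|f j v|.
  rewrite fu normrM normr_id ler_wpM2l// (le_trans _ (ler_norm _))//.
  have -> : f j u = `|z j| + f j (u - z j).
    have := bf.1 1 (u - z j) (z j); rewrite !scale1r subrK fz => ->.
    by rewrite addrC.
  have := le_trans (f1 (u - z j)) uz; rewrite ler_norml => /andP[+ _].
  have := ler_normD (u - z j) (z j); rewrite subrK nu; lra.
by move=> ve; rewrite mulrC (le_trans ve).
Qed.

End FiniteDim.

(** * Lipschitz ideals on finite metric spaces *)

Section LinearSums.
Context {R : realType} {V W : lmodType R} (f : V -> W).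
Hypothesis lf : linear f.

Lemma linear_funD u v : f (u + v) = f u + f v.
Proof. by rewrite -[u]scale1r lf !scale1r. Qed.

Lemma linear_funB u v : f (u - v) = f u - f v.
Proof. by rewrite addrC -scaleN1r lf scaleN1r addrC. Qed.

Lemma linear_fun_sum (I : Type) (s : seq I) (u : I -> V) :
  f (\sum_(i <- s) u i) = \sum_(i <- s) f (u i).
Proof. exact: (big_morph f linear_funD (linear_fun0 lf)). Qed.

Lemma linear_fun_comb (I : Type) (s : seq I) (a : I -> R) (u : I -> V) :
  f (\sum_(i <- s) a i *: u i) = \sum_(i <- s) a i *: f (u i).
Proof. by rewrite linear_fun_sum; apply: eq_bigr => i _; rewrite linear_funZ. Qed.

End LinearSums.

Section BoundedLinearMaps.
Context {R : realType}.

Lemma dual_le (F : completeNormedModType R) (y : dual F) w : `|y w| <= `|y| * `|w|.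
Proof. exact: (opnorm_le w (dual_bounded_linear y)). Qed.

Lemma bounded_linear_comp (U V W : normedModType R) (f : U -> V) (g : V -> W) :
  bounded_linear f -> bounded_linear g -> bounded_linear (g \o f).
Proof.
move=> bf bg; split; first by move=> a u v; rewrite /= bf.1 bg.1.
exists (opnorm g * opnorm f) => x; rewrite -mulrA (le_trans (opnorm_le _ bg))//.
by rewrite ler_wpM2l ?opnorm_ge0// opnorm_le.
Qed.

Lemma bounded_linear_sum (U V : normedModType R) (I : Type) (s : seq I)
    (f : I -> U -> V) : (forall i, bounded_linear (f i)) ->
  bounded_linear (fun u => \sum_(i <- s) f i u).
Proof.
move=> bf; split=> [a u v|].
  rewrite scaler_sumr -big_split/=; apply: eq_bigr => i _.
  by have [lf _] := bf i; rewrite lf.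
exists (\sum_(i <- s) opnorm (f i)) => u.
rewrite mulr_suml (le_trans (ler_norm_sum _ _ _))//.
by apply: ler_sum => i _; exact: opnorm_le.
Qed.

Lemma bounded_linear_rank1 (U V : normedModType R) (f : U -> R^o) (v : V) :
  bounded_linear f -> bounded_linear (fun u => f u *: v).
Proof.
move=> bf; split=> [a x y|]; first by rewrite bf.1 scalerDl scalerA.
exists (opnorm f * `|v|) => x.
by rewrite normrZ mulrAC ler_wpM2r// opnorm_le.
Qed.

Lemma bounded_linear_idfun (U : normedModType R) : bounded_linear (@idfun U).
Proof. by split=> //; exists 1 => x; rewrite mul1r. Qed.

Lemma opnorm_idfun_le (U : normedModType R) : opnorm (@idfun U) <= 1.
Proof. by apply: le_opnorm => // x; rewrite mul1r. Qed.

Lemma bounded_linear_scale (V : normedModType R) (v : V) :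
  bounded_linear (fun t : R^o => t *: v).
Proof. exact: (bounded_linear_rank1 v (bounded_linear_idfun R^o)). Qed.

Lemma opnorm_scale_le (V : normedModType R) (v : V) :
  opnorm (fun t : R^o => t *: v) <= `|v|.
Proof. by apply: le_opnorm => // t; rewrite normrZ mulrC. Qed.

Variable E : completeNormedModType R.
Implicit Type M : closedSubspace E.

Lemma bounded_linear_quot_pi M : bounded_linear (quot_pi M).
Proof.
split=> [a x y|]; first by rewrite quot_piD quot_piZ.
by exists 1 => x; rewrite mul1r; exact: quot_norm_le.
Qed.

Lemma opnorm_quot_pi_le M : opnorm (quot_pi M) <= 1.
Proof. by apply: le_opnorm => // x; rewrite mul1r; exact: quot_norm_le. Qed.

Lemma bounded_linear_subsp_val M : bounded_linear (@subsp_val R E M).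
Proof. by split=> //; exists 1 => x; rewrite mul1r. Qed.

Lemma opnorm_subsp_val_le M : opnorm (@subsp_val R E M) <= 1.
Proof. by apply: le_opnorm => // x; rewrite mul1r. Qed.

End BoundedLinearMaps.

Section LipschitzMaps.
Context {R : realType}.
Implicit Types X Y : pointedMetricType R.

Lemma banach_mdistE (E : completeNormedModType R) (x y : E) :
  mdist (x : banach_pm E) (y : banach_pm E) = `|x - y|.
Proof. by []. Qed.

Lemma lip_constP X Y (f : X -> Y) : lip0 f ->
  0 <= lip_const f /\ forall x y, mdist (f x) (f y) <= lip_const f * mdist x y.
Proof.
move=> [_ [C C0 fC]]; split.
  by apply: lb_le_inf; [exists C; split|move=> D []].
move=> x y; have [->|xy] := eqVneq x y; first by rewrite !mdistxx mulr0.
have d0 : 0 < mdist x y by rewrite mdist_gt0.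
rewrite -ler_pdivrMr//; apply: lb_le_inf; first by exists C; split.
by move=> D [_ fD]; rewrite ler_pdivrMr.
Qed.

Lemma lip_const_min X Y (f : X -> Y) (C : R) :
  0 <= C -> (forall x y, mdist (f x) (f y) <= C * mdist x y) -> lip_const f <= C.
Proof. by move=> C0 fC; apply: ge_inf; [exists 0 => D []|split]. Qed.

Lemma lip0_isometry X Y (f : X -> Y) :
  f point = point -> (forall x y, mdist (f x) (f y) = mdist x y) ->
  lip0 f /\ lip_const f <= 1.
Proof.
move=> f0 fd; split; first by split=> //; exists 1 => // x y; rewrite mul1r fd.
by apply: lip_const_min => // x y; rewrite mul1r fd.
Qed.

Lemma lip0_linear (E F : completeNormedModType R) (T : E -> F) :
  bounded_linear T -> lip0 (T : banach_pm E -> banach_pm F).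
Proof.
move=> bT; split; first exact: linear_fun0 bT.1.
exists (opnorm T) => [|x y]; first exact: opnorm_ge0.
by rewrite !banach_mdistE -(linear_funB bT.1) opnorm_le.
Qed.

End LipschitzMaps.

Section LipIdeal.
Context {R : realType} (I : banachLipIdeal R).
Implicit Types (X Y : pointedMetricType R) (E F H : completeNormedModType R).

Lemma lip_mem_submodule X E : submodule (@lip_mem R I X E).
Proof. by have [[]] := lip_banach I X E. Qed.

Lemma lip_norm_ge0 X E (f : X -> E) : lip_mem I f -> 0 <= lip_norm I f.
Proof. by have [_ + _ _ _] := lip_banach I X E => /(_ f)/[apply] -[]. Qed.

Lemma lip_norm_sublinear X E : sublinear_on (@lip_mem R I X E) (@lip_norm R I X E).
Proof.
have [_ _ ND NZ _] := lip_banach I X E.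
by split=> [u v|a u a0 Au]; [exact: ND|rewrite NZ ?ger0_norm].
Qed.

Lemma lip_memE X E (f : X -> E) : lip_mem I f ->
  f point = 0 /\ forall x y, `|f x - f y| <= lip_norm I f * mdist x y.
Proof.
move=> If; have lf := lip_lip0 If; split; first exact: lf.1.
move=> x y; apply: (le_trans ((lip_constP lf).2 x y)).
by rewrite ler_wpM2r ?mdist_ge0//; exact: lip_const_le.
Qed.

Lemma lip_norm_comp_le X Y E F (g : Y -> X) (f : X -> E) (S : E -> F) (a b : R) :
  lip0 g -> lip_mem I f -> bounded_linear S -> lip_const g <= a -> opnorm S <= b ->
  lip_mem I (S \o f \o g) /\ lip_norm I (S \o f \o g) <= a * lip_norm I f * b.
Proof.
move=> lg If bS ga Sb; have [m le] := lip_ideal lg If bS; split=> //.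
have lg0 := (lip_constP lg).1.
have n0 := lip_norm_ge0 If.
apply: (le_trans le); rewrite ler_pM ?opnorm_ge0// ?mulr_ge0//.
by rewrite ler_wpM2r.
Qed.

Lemma lip_mem_rank1 X E (s : X -> R^o) (v : E) :
  lip0 (s : X -> banach_pm R^o) -> lip_mem I (fun x => s x *: v).
Proof.
move=> ls.
exact: (lip_ideal ls (lip_id I).1 (bounded_linear_scale v)).1.
Qed.

Section FiniteMetricSpace.
Context {X : pointedMetricType R} (fX : finite_set [set: X]).

Lemma finite_enum : exists2 xs : seq X, uniq xs & forall x, x \in xs.
Proof.
have /finite_fsetP[A AX] := fX; exists (enum_fset A); first exact: fset_uniq.
by move=> x; have : [set: X] x by []; rewrite AX.
Qed.

Lemma finite_lip0 (s : X -> R^o) : s point = 0 -> lip0 (s : X -> banach_pm R^o).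
Proof.
move=> s0; split => //; have [xs uxs xsX] := finite_enum.
pose C (x y : X) := `|s x - s y| / mdist x y.
have C0 x y : 0 <= C x y by rewrite divr_ge0// mdist_ge0.
exists (\sum_(x <- xs) \sum_(y <- xs) C x y).
  by apply: sumr_ge0 => x _; apply: sumr_ge0.
move=> x y; rewrite banach_mdistE; have [->|xy] := eqVneq x y.
  by rewrite subrr normr0 mulr_ge0 ?mdist_ge0//; apply: sumr_ge0 => z _; apply: sumr_ge0.
have d0 : 0 < mdist x y by rewrite mdist_gt0.
rewrite -ler_pdivrMr// -/(C x y) (bigD1_seq x)//= (bigD1_seq y)//= -addrA lerDl.
by rewrite addr_ge0// sumr_ge0// => z _; apply: sumr_ge0.
Qed.

Let delta (E : completeNormedModType R) (x : X) (v : E) : X -> E :=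
  fun y => ((y == x)%:R : R) *: v.

Let delta_mem E x (v : E) : x != point -> lip_mem I (delta x v).
Proof.
move=> x0; apply: (@lip_mem_rank1 _ _ (fun y => (y == x)%:R)).
by apply: finite_lip0; rewrite eq_sym (negbTE x0).
Qed.

Let delta_sum E (xs : seq X) (g : X -> E) : uniq xs -> (forall x, x \in xs) ->
  g point = 0 -> g = \sum_(x <- xs | x != point) delta x (g x).
Proof.
move=> uxs xsX g0; apply/funext => y.
have -> : (\sum_(x <- xs | x != point) delta x (g x)) y =
    \sum_(x <- xs | x != point) delta x (g x) y.
  exact: (big_morph (fun h : X -> E => h y)).
have [->|y0] := eqVneq y point.
  by rewrite g0 big1// => x x0; rewrite /delta eq_sym (negbTE x0) scale0r.
rewrite -big_filter (bigD1_seq y) ?mem_filter ?y0 ?filter_uniq//=.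
rewrite /delta eqxx scale1r big1 ?addr0// => x xy.
by rewrite eq_sym (negbTE xy) scale0r.
Qed.

(** On a finite space every pointed map is a finite sum of rank-one Lipschitz maps, one for each
    point other than the base point. Only norms matter there. *)
Lemma finite_lip_mem E (g : X -> E) : g point = 0 -> lip_mem I g.
Proof.
move=> g0; have [xs uxs xsX] := finite_enum.
rewrite (delta_sum uxs xsX g0); apply: submodule_sum => [|x x0].
  exact: lip_mem_submodule.
exact: delta_mem.
Qed.

(** A norming functional of the component splits along point masses. The [f x] are not claimed to be
    continuous: they are only applied to finite combinations of fixed vectors, where linearity is
    enough. *)
Lemma finite_lip_norm_attained E (g : X -> E) : g point = 0 ->
  exists (xs : seq X) (f : X -> E -> R^o),
    [/\ forall x, linear (f x),
        forall h : X -> E, h point = 0 -> \sum_(x <- xs) f x (h x) <= lip_norm I h &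
        \sum_(x <- xs) f x (g x) = lip_norm I g].
Proof.
move=> g0; have [xs uxs xsX] := finite_enum.
have sI := lip_mem_submodule X E.
have [L [lL LN Lg]] :=
  hahn_banach_attained sI (lip_norm_sublinear X E) (finite_lip_mem g0).
(* A nonzero point mass at the base point is not in the ideal; the value [0] chosen there loses
   nothing because [h point = 0]. *)
pose f x (v : E) : R^o := if x == point then 0 else L (delta x v).
exists xs, f.
have Lf h : h point = 0 -> L h = \sum_(x <- xs) f x (h x).
  move=> h0; rewrite {1}(delta_sum uxs xsX h0) (linear_on_sum _ sI lL).
    by rewrite [RHS](bigID (fun x => x == point))/= [X in _ = X + _]big1 ?add0r;
      [apply: eq_bigr => x x0; rewrite /f (negbTE x0)|move=> x x0; rewrite /f x0].
  by move=> x x0; exact: delta_mem.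
split=> [x a u v|h h0|]; last by rewrite -Lf.
  rewrite /f; case: eqVneq => [_|x0]; first by rewrite scaler0 addr0.
  have -> : delta x (a *: u + v) = a *: delta x u + delta x v.
    by apply/funext => y; rewrite /delta scalerDr scalerA mulrC -scalerA.
  by rewrite lL//; exact: delta_mem.
by rewrite -Lf// LN//; exact: finite_lip_mem.
Qed.

End FiniteMetricSpace.

Lemma finite_subpm X (S : pointedSubset X) :
  finite_set (ps_set S) -> finite_set [set: subpm S].
Proof.
move=> fS; have : finite_set (@subpm_val R X S @^-1` ps_set S).
  by apply: finite_preimage fS => x y _ _; exact: val_inj.
apply: sub_finite_set => x _.
exact: set_mem (subpm_valP x).
Qed.

End LipIdeal.

(** * Maximality for maps into a dual space *)

Section WeakStar.
Context {R : realType} (I : banachLipIdeal R).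

Lemma dualN (F : completeNormedModType R) (y : dual F) z : y (- z) = - y z.
Proof.
have ly := (dual_bounded_linear y).1.
by rewrite -scaleN1r (linear_funZ _ _ ly) scaleN1r.
Qed.

Lemma dual_combE (F : completeNormedModType R) (T : Type) (s : seq T)
    (a : T -> R) (y : T -> dual F) z :
  (\sum_(i <- s) a i *: y i : dual F) z = \sum_(i <- s) a i * y i z.
Proof. exact: (big_morph (fun y : dual F => y z)). Qed.

Section DualTuples.
Context (F : completeNormedModType R) (m : nat).
Implicit Type w : 'I_m -> F.

Definition supnorm w : R := \big[Num.max/0]_j `|w j|.

Lemma supnorm_ge w j : `|w j| <= supnorm w.
Proof. by apply/bigmax_geP; right; exists j. Qed.

Lemma supnorm_le w (B : R) : 0 <= B -> (forall j, `|w j| <= B) -> supnorm w <= B.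
Proof. by move=> B0 wB; apply: bigmax_le. Qed.

Lemma supnorm_ge0 w : 0 <= supnorm w.
Proof. by apply/bigmax_geP; left. Qed.

Lemma sublinear_supnorm (K : R) : 0 <= K ->
  sublinear_on setT (fun w => K * supnorm w).
Proof.
move=> K0; split=> [u v _ _|a u a0 _].
  rewrite -mulrDr ler_wpM2l// supnorm_le ?addr_ge0 ?supnorm_ge0// => j.
  by rewrite (le_trans (ler_normD _ _))// lerD// supnorm_ge.
rewrite mulrCA ler_wpM2l// supnorm_le ?mulr_ge0 ?supnorm_ge0// => j.
by rewrite normrZ ger0_norm// ler_wpM2l// supnorm_ge.
Qed.

Let delta (j : 'I_m) (z : F) : 'I_m -> F := fun i => (i == j)%:R *: z.

(** The dual of a finite sup-sum of copies of [F] is the l1-sum of copies of [dual F]: evaluating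
    [L] at vectors that nearly norm all the [y j] at once bounds the sum of their norms, not just
    each of them. *)
Lemma supnorm_dual (K : R) (L : ('I_m -> F) -> R) : 0 <= K ->
  linear_on setT L -> (forall w, L w <= K * supnorm w) ->
  exists y : 'I_m -> dual F,
    (forall w, L w = \sum_j y j (w j)) /\ \sum_j `|y j| <= K.
Proof.
move=> K0 lL LK; have sT : submodule (setT : set ('I_m -> F)) by [].
have ly j : linear (fun z => L (delta j z) : R^o).
  move=> a u v; rewrite -lL//; congr L; apply/funext => i.
  by rewrite /delta scalerDr scalerA mulrC -scalerA.
have yb j z : `|L (delta j z)| <= K * `|z|.
  have dz v : supnorm (delta j v) <= `|v|.
    apply: supnorm_le => // i; rewrite /delta; case: (i == j); rewrite ?scale1r//.
    by rewrite scale0r normr0.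
  rewrite ler_norml lerNl; apply/andP; split; last first.
    by rewrite (le_trans (LK _))// ler_wpM2l.
  rewrite -(linear_onN sT lL)//.
  have -> : - delta j z = delta j (- z).
    by apply/funext => i; rewrite /delta scalerN.
  by rewrite (le_trans (LK _))// -(normrN z) ler_wpM2l.
have by_ j : (fun z => L (delta j z) : R^o) \in @functional_pred R F.
  by apply/functional_predP; split; [exact: ly|exists K => z; exact: yb].
have [y yE] : exists y : 'I_m -> dual F, forall j z, y j z = L (delta j z).
  by exists (fun j => Dual (by_ j)).
exists y.
have Lw w : L w = \sum_j y j (w j).
  under eq_bigr do rewrite yE.
  rewrite -(linear_on_sum _ sT lL)//; congr L; apply/funext => i.
  rewrite fct_sumE (bigD1 i)//= /delta eqxx scale1r big1 ?addr0// => j ji.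
  by rewrite eq_sym (negbTE ji) scale0r.
split=> //; apply/ler_addgt0Pr => e e0.
(* [m.+1] instead of [m] keeps the quotient positive when [m = 0]. *)
have em : 0 < e / m.+1%:R by rewrite divr_gt0.
have /choice[z zP] (j : 'I_m) : exists z : F, `|z| <= 1 /\ `|y j| - e / m.+1%:R <= y j z.
  have [_ [z /= z1 <-] yz] := sup_adherent em (opnorm_has_sup (dual_bounded_linear (y j))).
  have [yz0|yz0] := leP 0 (y j z).
    by exists z; split=> //; rewrite ger0_norm// in yz; exact: ltW.
  exists (- z); rewrite normrN; split=> //.
  rewrite ltr0_norm// in yz.
  by rewrite dualN ltW.
have : L z <= K.
  rewrite (le_trans (LK _))// ler_piMr// supnorm_le// => j.
  by have [] := zP j.
have : \sum_j (`|y j| - e / m.+1%:R) <= L z.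
  by rewrite Lw; apply: ler_sum => j _; have [] := zP j.
rewrite sumrB sumr_const card_ord => + LzK.
rewrite lerBlDr => /le_trans; apply; rewrite lerD// -[_ *+ m]mulr_natr.
by rewrite mulrAC ler_pdivrMr// ler_wpM2l ?ler_nat ?ltW.
Qed.

End DualTuples.

(* The bound of [Q \o g] for an arbitrary finite-dimensional quotient [Q] of
   [dual F] follows from the weak*-continuous ones by a weak form of the
   principle of local reflexivity: the functional attaining the norm of
   [Q \o g] extends, through almost norming functionals of the quotient, to a
   finite sequence of functionals on [F]. *)
Lemma weak_star_quotient_bound (X : pointedMetricType R) (F H : completeNormedModType R)
    (g : X -> dual F) (q : dual F -> H) (c : R) :
  finite_set [set: X] -> finite_dim H -> 0 <= c -> g point = 0 ->
  bounded_linear q -> opnorm q <= 1 ->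
  (forall n (v : 'I_n -> F) (h : 'I_n -> H) (B : R), 0 <= B ->
    (forall y : dual F, `|\sum_i y (v i) *: h i| <= B * `|y|) ->
    lip_norm I (fun x => \sum_i g x (v i) *: h i) <= c * B) ->
  lip_norm I (q \o g) <= c.
Proof.
move=> fX fH c0 g0 bq q1 gc.
have Gp : (q \o g) point = 0 by rewrite /= g0 (linear_fun0 bq.1).
have [xs [f [lf fN fG]]] := finite_lip_norm_attained I fX Gp.
have [n [b [cc [bcc ccE]]]] := finite_dim_coordinates fH.
apply: (le_of_le_mul1B c0) => e e0 e1; have e1' : 0 < 1 - e by rewrite subr_gt0.
have [m [fj [bfj fj1 fjH]]] := finite_dim_norming_functionals fH e0.
set K := c / (1 - e); have K0 : 0 <= K by rewrite divr_ge0// ltW.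
(* A tuple [v] encodes the weak*-continuous map sending [y] to the sum of the [y (v k) *: b k]. The
   tuple [u v] lists its compositions with the [fj j], which are vectors of [F], so that
   [supnorm (u v)] controls its norm up to [1 - e]; [r v] is the norming functional evaluated at its
   composition with [g]. *)
pose u (v : 'I_n -> F) : 'I_m -> F := fun j => \sum_k fj j (b k) *: v k.
pose r (v : 'I_n -> F) : R := \sum_(x <- xs) f x (\sum_k g x (v k) *: b k).
have lg x : linear (g x) := (dual_bounded_linear (g x)).1.
have gsum x (v v' : 'I_n -> F) a : \sum_k g x ((a *: v + v') k) *: b k =
    a *: (\sum_k g x (v k) *: b k) + \sum_k g x (v' k) *: b k.
  rewrite scaler_sumr -big_split/=; apply: eq_bigr => k _.
  by rewrite [g x _]lg scalerDl scalerA.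
have rL a v v' : r (a *: v + v') = a * r v + r v'.
  rewrite /r mulr_sumr -big_split/=; apply: eq_bigr => x _.
  by rewrite gsum lf.
have uL a v v' : u (a *: v + v') = a *: u v + u v'.
  apply/funext => j; rewrite /u.
  have -> : (a *: (fun j => \sum_k fj j (b k) *: v k) +
      (fun j => \sum_k fj j (b k) *: v' k)) j =
      a *: (\sum_k fj j (b k) *: v k) + \sum_k fj j (b k) *: v' k by [].
  rewrite scaler_sumr -big_split/=; apply: eq_bigr => k _.
  by rewrite scalerDr !scalerA mulrC.
have rK v : r v <= K * supnorm (u v).
  have vB (y : dual F) : `|\sum_i y (v i) *: b i| <= supnorm (u v) / (1 - e) * `|y|.
    rewrite mulrAC ler_pdivlMr// mulrC; apply: fjH => j.
    have -> : fj j (\sum_i y (v i) *: b i) = y (u v j).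
      rewrite (linear_fun_comb (bfj j).1) (linear_fun_comb (dual_bounded_linear y).1).
      by apply: eq_bigr => k _; exact: mulrC.
    by rewrite (le_trans (dual_le _ _))// mulrC ler_wpM2r// supnorm_ge.
  have B0 : 0 <= supnorm (u v) / (1 - e) by rewrite divr_ge0 ?supnorm_ge0// ltW.
  have h0 : \sum_k g point (v k) *: b k = 0.
    by rewrite g0 big1// => k _; rewrite scale0r.
  rewrite (le_trans (fN (fun x => \sum_k g x (v k) *: b k) h0))//.
  by rewrite (le_trans (gc _ _ _ _ B0 vB))// mulrA mulrAC.
have u0 : u 0 = 0 by have := uL (-1) 0 0; rewrite scaler0 addr0 scaleN1r addNr.
have r0 : r 0 = 0 by have := rL (-1) 0 0; rewrite scaler0 addr0 mulN1r addNr.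
have sT : submodule (setT : set ('I_m -> F)) by [].
(* Extends the assignment of [r v] to [u v] to all [m]-tuples, without asking [u] to be
   injective. *)
have [||||L [lL LK LL]] := @mazur_orlicz _ _ setT (fun w => K * supnorm w)
  (fun w t => exists v, w = u v /\ t = r v) sT (sublinear_supnorm F m K0).
- by exists 0; rewrite u0 r0.
- move=> _ _ _ _ [v [-> ->]] [v' [-> ->]]; exists (v + v').
  by have := uL 1 v v'; have := rL 1 v v'; rewrite !scale1r mul1r => -> ->.
- move=> a _ _ _ [v [-> ->]]; exists (a *: v).
  by have := uL a v 0; have := rL a v 0; rewrite u0 r0 !addr0 => -> ->.
- by move=> _ _ [v [-> ->]].
have LE v : L (u v) = r v.
  apply/eqP; rewrite eq_le [X in _ && X]LL ?andbT; last by exists v.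
  have : r (- v) <= L (u (- v)) by apply: LL; exists (- v).
  have := uL (-1) v 0; have := rL (-1) v 0; rewrite u0 r0 !addr0 !scaleN1r mulN1r.
  by move=> -> ->; rewrite (linear_onN sT lL)// lerN2.
have [y [yL yK]] := supnorm_dual K0 lL (fun w => LK w Logic.I).
(* Tuples supported at the index [k] turn the scalar identity [LE] into one in [dual F], to which
   any linear [q] can be applied. *)
have key k : \sum_(x <- xs) f x (b k) *: g x = \sum_j fj j (b k) *: y j.
  apply: val_inj; apply/funext => z; rewrite [LHS]dual_combE [RHS]dual_combE.
  pose v i : F := (i == k)%:R *: z.
  have single (V : lmodType R) (w : 'I_n -> V) :
      \sum_i (i == k)%:R *: w i = w k :> V.
    rewrite (bigD1 k)//= eqxx scale1r big1 ?addr0// => i ik.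
    by rewrite (negbTE ik) scale0r.
  have := LE v; rewrite yL /r => uvr; transitivity (\sum_j y j (u v j)).
    rewrite uvr; apply: eq_bigr => x _.
    have -> : \sum_i g x (v i) *: b i = g x z *: b k.
      rewrite -[RHS](single _ (fun i => g x z *: b i)); apply: eq_bigr => i _.
      by rewrite (linear_funZ _ _ (lg x)) scalerA.
    by rewrite (linear_funZ _ _ (lf x)); exact: mulrC.
  apply: eq_bigr => j _.
  have -> : u v j = fj j (b k) *: z.
    rewrite /u /v -[RHS](single _ (fun i => fj j (b i) *: z)).
    by apply: eq_bigr => i _; rewrite !scalerA mulrC.
  by rewrite (linear_funZ _ _ (dual_bounded_linear (y j)).1).
(* [q] need not be weak*-continuous, but by [key] it now acts only on the [y j], whose norms add up
   to at most [K]. *)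
have -> : lip_norm I (q \o g) = \sum_j fj j (q (y j)).
  rewrite -fG.
  transitivity (\sum_k cc k (q (\sum_(x <- xs) f x (b k) *: g x))).
    under [RHS]eq_bigr do
      rewrite (linear_fun_comb bq.1) (linear_fun_comb (bcc _).1).
    rewrite exchange_big/=; apply: eq_bigr => x _.
    rewrite [in LHS](ccE (q (g x))) (linear_fun_comb (lf x)).
    by apply: eq_bigr => k _; exact: mulrC.
  under eq_bigr do rewrite key (linear_fun_comb bq.1) (linear_fun_comb (bcc _).1).
  rewrite exchange_big/=; apply: eq_bigr => j _.
  rewrite [in RHS](ccE (q (y j))) (linear_fun_comb (bfj j).1).
  by apply: eq_bigr => k _; exact: mulrC.
rewrite -ler_pdivlMl// mulrC (le_trans _ yK)//; apply: ler_sum => j _.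
rewrite (le_trans (ler_norm _))// (le_trans (fj1 _ _))//.
rewrite (le_trans (opnorm_le _ bq))//.
by rewrite ler_piMl.
Qed.

(** Replaces the quotient maps in the definition of maximality by finite sums of evaluations at
    vectors of [F], which commute with a mean taken pointwise on [F]. *)
Lemma weak_star_maximal (X : pointedMetricType R) (F : completeNormedModType R)
    (g : X -> dual F) (c : R) :
  lip_maximal I -> lip0 (g : X -> banach_pm (dual F)) -> 0 <= c ->
  (forall (X0 : pointedSubset X) (H : completeNormedModType R) n
      (v : 'I_n -> F) (h : 'I_n -> H) (B : R),
    finite_set (ps_set X0) -> 0 <= B ->
    (forall y : dual F, `|\sum_i y (v i) *: h i| <= B * `|y|) ->
    lip_norm I (fun x : subpm X0 => \sum_i g (subpm_val x) (v i) *: h i) <= c * B) ->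
  lip_mem I g /\ lip_norm I g <= c.
Proof.
move=> Imax lg c0 gc; have [memE normE] := Imax _ _ _ lg.
have maxc : (lip_max_norm I g <= c%:E)%E.
  apply: ge_ereal_sup => _ [X0 [M [fX0 fM ->]]].
  have g0 : (g \o @subpm_val R X X0) point = 0 by exact: lg.1.
  have fX := finite_subpm fX0.
  have q0 : (quot_pi M \o (g \o @subpm_val R X X0)) point = 0.
    by rewrite [LHS]/= [g _]g0 (linear_fun0 (bounded_linear_quot_pi M).1).
  rewrite /lip_enorm asboolT; last exact: finite_lip_mem.
  rewrite lee_fin; apply: (weak_star_quotient_bound fX fM c0 g0).
  - exact: bounded_linear_quot_pi.
  - exact: opnorm_quot_pi_le.
  - by move=> n v h B B0 vB; exact: gc.
have Ig : lip_mem I g by apply/memE; exact: le_lt_trans maxc (ltry _).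
by split=> //; rewrite -lee_fin normE.
Qed.

End WeakStar.

(** * Linearization by averaging *)

Section Averaging.
Context {R : realType} (I : banachLipIdeal R).
Context (E F : completeNormedModType R) (f : banach_pm E -> dual F).
Hypotheses (If : lip_mem I f) (Itr : translation_invariant I).

(** Translation invariance speaks of maps on subsets, so [E] has to be seen as a subset of
    itself. *)
Let whole : pointedSubset (banach_pm E) := @PointedSubset R (banach_pm E) setT Logic.I.

(* Translating by [y] puts the increment [f (x + y) - f y] in the ideal. *)
Lemma increment_lip_norm (X0 : pointedSubset (banach_pm E)) (y : E)
    (H : completeNormedModType R) (S : dual F -> H) (B : R) :
  bounded_linear S -> opnorm S <= B ->
  let g := fun x : subpm X0 => S (f ((subpm_val x : E) + y) - f y) in
  lip_mem I g /\ lip_norm I g <= B * lip_norm I f.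
Proof.
move=> bS SB g.
have [val0 val1] : lip0 (@subpm_val R _ whole) /\ lip_const (@subpm_val R _ whole) <= 1.
  exact: lip0_isometry.
have [] := lip_norm_comp_le val0 If (bounded_linear_idfun (dual F)) val1 (opnorm_idfun_le _).
rewrite mul1r mulr1 => Iw Nw.
pose y' : subpm whole := SubPM (mem_set (Logic.I : ps_set whole y)).
have [Itr_mem Itr_norm] := Itr y' (lip_lip0 Iw).
have sh (x : subpm X0) : (subpm_val x : banach_pm E) \in ps_set (Defs.shift y').
  by apply/mem_set; exists ((subpm_val x : E) + y); rewrite //= addrK.
pose emb x : subpm (Defs.shift y') := SubPM (sh x).
have [emb0 emb1] : lip0 emb /\ lip_const emb <= 1.
  by apply: lip0_isometry => //; exact: val_inj.
have [Ig Ng] := lip_norm_comp_le emb0 (Itr_mem.1 Iw) bS emb1 SB.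
split=> //; apply: (le_trans Ng); rewrite mul1r mulrC ler_wpM2l//.
  exact: le_trans (opnorm_ge0 bS) SB.
by rewrite -Itr_norm.
Qed.

Context (L : (E -> R^o) -> R) (mL : mean L) (T : E -> dual F).
Hypothesis TE : forall x w, T x w = L (fun y => (f (x + y) - f y) w).

Lemma increment_bound x y w : `|(f (x + y) - f y) w| <= lip_norm I f * `|x| * `|w|.
Proof.
rewrite (le_trans (dual_le _ _))// ler_wpM2r//.
by have := (lip_memE If).2 (x + y : E) y; rewrite banach_mdistE addrK.
Qed.

Lemma increment_bdd x w : bdd (fun y => (f (x + y) - f y) w : R^o).
Proof. by exists (lip_norm I f * `|x| * `|w|) => y; exact: increment_bound. Qed.

(** The functional attaining the norm on [X0] involves finitely many points [x] and vectors [v i].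
    Its value at the average is thus the mean over [y] of its values at the increments, each at most
    [B * lip_norm I f] by translation invariance. *)
Lemma mean_increment_lip_norm (X0 : pointedSubset (banach_pm E))
    (H : completeNormedModType R) n (v : 'I_n -> F) (h : 'I_n -> H) (B : R) :
  finite_set (ps_set X0) -> 0 <= B ->
  (forall y : dual F, `|\sum_i y (v i) *: h i| <= B * `|y|) ->
  lip_norm I (fun x : subpm X0 => \sum_i T (subpm_val x) (v i) *: h i) <=
    lip_norm I f * B.
Proof.
move=> fX0 B0 vB; have fX := finite_subpm fX0.
set g := fun x : subpm X0 => _.
have T0 w : T 0 w = 0.
  rewrite TE -[RHS](mean_cst mL 0); congr L; apply/funext => y.
  by rewrite add0r subrr.
have g0 : g point = 0 by rewrite /g big1// => i _; rewrite T0 scale0r.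
have [xs [p [lp pN <-]]] := finite_lip_norm_attained I fX g0.
pose S (y : dual F) : H := \sum_i y (v i) *: h i.
have bS : bounded_linear S.
  split=> [a y z|]; last by exists B.
  rewrite /S scaler_sumr -big_split/=; apply: eq_bigr => i _.
  by rewrite scalerA -scalerDl.
pose J (y : E) (x : subpm X0) := S (f ((subpm_val x : E) + y) - f y).
have SB : opnorm S <= B by exact: le_opnorm.
have pJE x : (fun y => p x (J y x)) = (fun y => \sum_i p x (h i) *
    (f ((subpm_val x : E) + y) - f y) (v i)).
  apply/funext => y; rewrite /J (linear_fun_comb (lp x)).
  by apply: eq_bigr => i _; exact: mulrC.
have bi x i : bdd (fun y => p x (h i) * (f ((subpm_val x : E) + y) - f y) (v i) : R^o).
  exact: (bddZ _ (increment_bdd _ _)).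
have pJb x : bdd (fun y => p x (J y x)) by rewrite pJE; exact: bdd_sum.
have -> : \sum_(x <- xs) p x (g x) = L (fun y => \sum_(x <- xs) p x (J y x)).
  rewrite (mean_sum mL)//; apply: eq_bigr => x _.
  rewrite /g (linear_fun_comb (lp x)) pJE (mean_sum mL)//.
  apply: eq_bigr => i _; rewrite (meanZ mL); last exact: increment_bdd.
  by rewrite -TE; exact: mulrC.
apply: (mean_le mL); first exact: bdd_sum.
move=> y; have [IJ NJ] := increment_lip_norm X0 y bS SB.
rewrite mulrC (le_trans _ NJ)//; apply: pN.
have -> : J y point = S (f (0 + y) - f y) by [].
by rewrite add0r subrr (linear_fun0 bS.1).
Qed.

End Averaging.

Section LinearExtension.
Context {R : realType} (I : banachLipIdeal R) (E F : completeNormedModType R).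
Context (E0 : closedSubspace E) (f : banach_pm E -> dual F) (T : subsp E0 -> dual F).
Hypotheses (Imax : lip_maximal I) (Itr : translation_invariant I) (If : lip_mem I f).
Hypotheses (lT : linear T) (fT : forall x : subsp E0, f (subsp_val x) = T x).

Lemma linear_extension : exists S : E -> dual F,
  [/\ bounded_linear S, lip_mem I (S : banach_pm E -> dual F),
      lip_norm I (S : banach_pm E -> dual F) <= lip_norm I f &
      forall x : subsp E0, S (subsp_val x) = T x].
Proof.
have [M [mM Minv]] : exists M : (E -> R^o) -> R,
    mean M /\ forall (g : E -> R^o) t, bdd g -> M (fun x => g (x + t)) = M g.
  exact: invariant_mean.
have [M0 [mM0 M0inv]] : exists M0 : (subsp E0 -> R^o) -> R,
    mean M0 /\ forall (g : subsp E0 -> R^o) t, bdd g -> M0 (fun x => g (x + t)) = M0 g.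
  exact: invariant_mean.
(* The outer mean makes [L] invariant under [E], for additivity; the inner mean over [E0] serves the
   extension property. *)
pose L (g : E -> R^o) := M (fun y => M0 (fun z => g (y + subsp_val z))).
have bdd0 (g : E -> R^o) (y : E) : bdd g -> bdd (fun z : subsp E0 => g (y + subsp_val z)).
  by move=> [B gB]; exists B.
have bdd1 (g : E -> R^o) : bdd g -> bdd (fun y => M0 (fun z => g (y + subsp_val z)) : R^o).
  by move=> [B gB]; exists B => y; exact: (mean_norm mM0).
have mL : mean L.
  split=> [a u v bu bv|g B bg gB]; last first.
    apply: (mean_le mM) => [|y]; first exact: bdd1.
    by apply: (mean_le mM0) => //; exact: bdd0.
  rewrite /L -(meanZ mM); last exact: (bdd1 _ bu).
  rewrite -(meanD mM); [|exact: (bddZ _ (bdd1 _ bu))|exact: (bdd1 _ bv)].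
  congr M; apply/funext => y.
  rewrite -(meanZ mM0); last exact: (bdd0 _ _ bu).
  by rewrite -(meanD mM0); [|exact: (bddZ _ (bdd0 _ _ bu))|exact: (bdd0 _ _ bv)].
have Linv g t : bdd g -> L (fun x => g (x + t)) = L g.
  move=> bg; rewrite /L -(Minv _ t (bdd1 _ bg)); congr M; apply/funext => y.
  by congr M0; apply/funext => z; rewrite addrAC.
pose incr x w (y : E) : R^o := (f (x + y) - f y) w.
have incrb x w y : `|incr x w y| <= lip_norm I f * `|x| * `|w| by exact: increment_bound.
have incr_bdd x w : bdd (incr x w) by exact: (increment_bdd If).
have SP x : (fun w => L (incr x w) : R^o) \in @functional_pred R F.
  apply/functional_predP; split=> [a u v|]; last first.
    by exists (lip_norm I f * `|x|) => w; exact: (mean_norm mL).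
  rewrite -[RHS]/(a * L (incr x u) + L (incr x v)) -(mean_linear mL)//.
  congr L; apply/funext => y.
  exact: (dual_bounded_linear (f (x + y) - f y)).1.
pose S x : dual F := Dual (SP x).
have SE x w : S x w = L (incr x w) by [].
have Sb x : `|S x| <= lip_norm I f * `|x|.
  apply: le_opnorm => [|w]; first by rewrite mulr_ge0// lip_norm_ge0.
  exact: (mean_norm mL).
(* Increments satisfy a cocycle identity, and invariance of [L] removes the shift by [x'] in it. *)
have SD x x' : S (x + x') = S x + S x'.
  apply: val_inj; apply/funext => w; rewrite -[RHS]/(S x w + S x' w) -[LHS]/(S (x + x') w) !SE.
  rewrite -(Linv _ x' (incr_bdd x w)) -(meanD mL)//; last first.
    by exists (lip_norm I f * `|x| * `|w|) => y.
  congr L; apply/funext => y.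
  have -> : incr (x + x') w y = incr x w (x' + y) + incr x' w y.
    transitivity ((f (x + (x' + y)) - f (x' + y) + (f (x' + y) - f y) : dual F) w) => //.
    by rewrite subrKA addrA.
  by rewrite [x' + y]addrC.
have bS : bounded_linear S.
  by split; [exact: additive_bounded_linear SD Sb|exists (lip_norm I f)].
have [IS NS] : lip_mem I (S : banach_pm E -> dual F) /\
    lip_norm I (S : banach_pm E -> dual F) <= lip_norm I f.
  apply: (weak_star_maximal Imax); first exact: lip0_linear.
    exact: lip_norm_ge0.
  move=> X0 H n v h B fX0 B0 vB.
  exact: (mean_increment_lip_norm If Itr mL).
exists S; split=> // x; apply: val_inj; apply/funext => w.
rewrite -[LHS]/(S (subsp_val x) w) SE /L -[RHS](mean_cst mM).
congr M; apply/funext => y.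
(* [f (y + z) - f z] has the same mean over [z] in [E0] as its translate by [x]. *)
pose g (z : subsp E0) : R^o := incr y w (subsp_val z).
have bg : bdd g by have [B gB] := incr_bdd y w; exists B => z; exact: gB.
have bgx : bdd (fun z => g (z + x)) by have [B gB] := bg; exists B => z; exact: gB.
have -> : (fun z => incr (subsp_val x) w (y + subsp_val z)) =
    (fun z => (g (z + x) - g z) + T x w).
  apply/funext => z; rewrite /g /incr.
  transitivity (((f (y + subsp_val (z + x)) - f (subsp_val (z + x))) -
      (f (y + subsp_val z) - f (subsp_val z)) + T x : dual F) w) => //.
  have -> : subsp_val x + (y + subsp_val z) = y + subsp_val (z + x).
    by rewrite addrCA [subsp_val x + _]addrC.
  congr (dual_fun _ w); rewrite !fT (linear_funD lT).
  by rewrite [RHS]addrAC opprB opprD !addrA !subrK.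
rewrite (meanD mM0); [|exact: bddB bgx bg|exact: bdd_cst].
by rewrite (mean_cst mM0) (meanB mM0)// M0inv// subrr add0r.
Qed.

End LinearExtension.

(** * A Lipschitz ideal with prescribed linear part *)

Section OperatorIdeal.
Context {R : realType} (A : banachOperatorIdeal R).
Implicit Types E F G H : completeNormedModType R.

Lemma op_mem_submodule E F : submodule (@op_mem R A E F).
Proof. by have [[]] := op_banach A E F. Qed.

Lemma op_norm_ge0 E F (T : E -> F) : op_mem A T -> 0 <= op_norm A T.
Proof. by have [_ + _ _ _] := op_banach A E F => /(_ T)/[apply] -[]. Qed.

Lemma op_normD E F (S T : E -> F) : op_mem A S -> op_mem A T ->
  op_norm A (S + T) <= op_norm A S + op_norm A T.
Proof. by have [_ _ + _ _] := op_banach A E F; exact. Qed.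

Lemma op_normZ E F a (T : E -> F) : op_mem A T ->
  op_norm A (a *: T) = `|a| * op_norm A T.
Proof. by have [_ _ _ + _] := op_banach A E F; exact. Qed.

Lemma op_norm_sublinear E F : sublinear_on (@op_mem R A E F) (@op_norm R A E F).
Proof.
by split=> [u v|a u a0 Au]; [exact: op_normD|rewrite op_normZ ?ger0_norm].
Qed.

Lemma op_norm_comp_le G E F H (U : G -> E) (T : E -> F) (S : F -> H) (a b : R) :
  bounded_linear U -> op_mem A T -> bounded_linear S -> opnorm U <= a -> opnorm S <= b ->
  op_mem A (S \o T \o U) /\ op_norm A (S \o T \o U) <= b * op_norm A T * a.
Proof.
move=> bU AT bS Ua Sb; have [m le] := op_ideal bU AT bS; split=> //.
have n0 := op_norm_ge0 AT.
apply: (le_trans le); rewrite ler_pM ?opnorm_ge0// ?mulr_ge0 ?opnorm_ge0//.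
by rewrite ler_wpM2r.
Qed.

Lemma op_rank1 G E (g : G -> R^o) (v : E) : bounded_linear g ->
  op_mem A (fun z => g z *: v) /\ op_norm A (fun z => g z *: v) <= `|v| * opnorm g.
Proof.
move=> bg; have [] := op_norm_comp_le bg (op_id A).1 (bounded_linear_scale v)
  (lexx _) (opnorm_scale_le v).
by rewrite (op_id A).2 mulr1.
Qed.

Lemma op_finite_rank G E (J : Type) (s : seq J) (g : J -> G -> R^o) (v : J -> E) :
  (forall i, bounded_linear (g i)) ->
  op_mem A (fun z => \sum_(i <- s) g i z *: v i) /\
  op_norm A (fun z => \sum_(i <- s) g i z *: v i) <= \sum_(i <- s) `|v i| * opnorm (g i).
Proof.
move=> bg; have -> : (fun z => \sum_(i <- s) g i z *: v i) =
    \sum_(i <- s) (fun z => g i z *: v i).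
  by apply/funext => z; rewrite fct_sumE.
elim: s => [|i s [mem le]].
  rewrite !big_nil; split; first by have [] := op_mem_submodule G E.
  have m0 := (op_mem_submodule G E).1.
  by rewrite -(scale0r 0) op_normZ// normr0 mul0r.
rewrite !big_cons; have [m1 le1] := op_rank1 (v i) (bg i).
split; first exact: submoduleD (op_mem_submodule G E) m1 mem.
by rewrite (le_trans (op_normD m1 mem))// lerD.
Qed.

(** Composing [V] with a functional norming [V 1] gives [|V 1|] times the identity of the reals,
    whose ideal norm is [1]. *)
Lemma op_norm_ge_value E (V : R^o -> E) : op_mem A V -> `|V 1| <= op_norm A V.
Proof.
move=> AV; have [f [bf fV f1]] := norming_functional (V 1).
have f1' : opnorm f <= 1 by apply: le_opnorm => // y; rewrite mul1r.
have [AfV] := op_norm_comp_le (bounded_linear_idfun R^o) AV bf (opnorm_idfun_le _) f1'.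
rewrite mul1r mulr1; apply: le_trans.
have -> : (f \o V) \o idfun = `|V 1| *: @idfun R^o.
  apply/funext => t; rewrite -[RHS]/(`|V 1| * t) /=.
  have -> : t = t *: (1 : R^o) by rewrite [RHS]mulr1.
  rewrite (linear_funZ _ _ (op_bounded_linear AV).1) (linear_funZ _ _ bf.1) fV.
  by rewrite [_ *: 1]mulr1; exact: mulrC.
rewrite op_normZ; last exact: (op_id A).1.
by rewrite [X in _ * X](_ : _ = 1) ?mulr1 ?normr_id//; exact: (op_id A).2.
Qed.

End OperatorIdeal.

(** * The Lipschitz hull of an operator ideal *)

Section LipHull.
Context {R : realType} (A : banachOperatorIdeal R).
Implicit Types (X Y : pointedMetricType R) (E F G H : completeNormedModType R).

Section Molecules.
Context (X : pointedMetricType R) (G : completeNormedModType R) (J : finType).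
Context (g : J -> G -> R^o) (x : J -> X).

Definition molecule_map (E : lmodType R) (f : X -> E) (z : G) : E :=
  \sum_i g i z *: f (x i).

(** The test functions [s] are not normalized at the base point. Arbitrarily large constants are
    admissible, which forces the coefficients to sum to zero and makes the notion independent of the
    base point. *)
Definition molecule_bound (B : R) : Prop :=
  forall s : J -> R, (forall i j, `|s i - s j| <= mdist (x i) (x j)) ->
  forall z, `|\sum_i s i * g i z| <= B * `|z|.

Lemma molecule_bound_scale (B C : R) (s : J -> R) : 0 < C -> molecule_bound B ->
  (forall i j, `|s i - s j| <= C * mdist (x i) (x j)) ->
  forall z, `|\sum_i s i * g i z| <= C * B * `|z|.
Proof.
move=> C0 gB sC z; have := gB (fun i => C^-1 * s i) _ z.
have -> : \sum_i C^-1 * s i * g i z = C^-1 * \sum_i s i * g i z.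
  by rewrite mulr_sumr; apply: eq_bigr => i _; rewrite mulrA.
rewrite normrM gtr0_norm ?invr_gt0// ler_pdivrMl// mulrA; apply=> i j.
by rewrite -mulrBr normrM gtr0_norm ?invr_gt0// ler_pdivrMl.
Qed.

Lemma molecule_bound_total (B : R) z : molecule_bound B -> \sum_i g i z = 0.
Proof.
move=> gB; apply/normr0_eq0/eqP; rewrite eq_le normr_ge0 andbT.
have B0 : 0 <= B * `|z|.
  apply: le_trans (normr_ge0 _) (gB (fun=> 0) _ z) => i j.
  by rewrite subrr normr0 mdist_ge0.
apply: (le0_of_le_divn B0) => n.
have := gB (fun=> n.+1%:R) _ z; rewrite -mulr_sumr normrM mulrC normr_nat; apply=> i j.
by rewrite subrr normr0 mdist_ge0.
Qed.

End Molecules.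

(* [molecule_bound g x B] says that [z |-> \sum_i g i z delta_(x i)] has norm at
   most [B] as an operator from [G] into the Lipschitz-free space of [X], and
   [molecule_map g x f] is its composition with the linearization of [f]; so [c]
   bounds the [A]-norm of the linearization of [f]. *)
Definition hull_bound X E (f : X -> E) (c : R) : Prop :=
  forall G (J : finType) (g : J -> G -> R^o) (x : J -> X) (B : R),
    (forall i, bounded_linear (g i)) -> 0 <= B -> molecule_bound g x B ->
    op_norm A (molecule_map g x f) <= c * B.

Definition hull_mem X E : set (X -> E) :=
  [set f | f point = 0 /\ exists2 c : R, 0 <= c & hull_bound f c].

Definition hull_norm X E (f : X -> E) : R :=
  inf [set c | 0 <= c /\ hull_bound f c].

Lemma molecule_map_mem X E G (J : finType) (g : J -> G -> R^o) (x : J -> X) (f : X -> E) :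
  (forall i, bounded_linear (g i)) -> op_mem A (molecule_map g x f).
Proof. by move=> bg; exact: (op_finite_rank _ _ (fun i => f (x i)) bg).1. Qed.

Lemma hull_norm_le X E (f : X -> E) (c : R) :
  0 <= c -> hull_bound f c -> hull_norm f <= c.
Proof. by move=> c0 fc; apply: ge_inf; [exists 0 => d []|split]. Qed.

Lemma hull_norm_ge0 X E (f : X -> E) : hull_mem f -> 0 <= hull_norm f.
Proof. by move=> [_ [c c0 fc]]; apply: lb_le_inf; [exists c|move=> d []]. Qed.

Lemma hull_norm_bound X E (f : X -> E) : hull_mem f -> hull_bound f (hull_norm f).
Proof.
move=> [f0 [c c0 fc]] G J g x B bg B0 gB.
move: B0; rewrite le_eqVlt => /predU1P[B0|B0].
  by have := fc _ _ _ _ _ bg (lexx 0); rewrite -B0 !mulr0 in gB *; apply.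
rewrite -ler_pdivrMr//; apply: lb_le_inf; first by exists c.
by move=> d [d0 fd]; rewrite ler_pdivrMr//; apply: fd => //; exact: ltW.
Qed.

(** Tests on the molecule [delta_x - delta_y], seen as an operator from the reals of norm at most
    [mdist x y]. *)
Lemma hull_bound_lip X E (f : X -> E) (c : R) x y :
  hull_bound f c -> `|f x - f y| <= c * mdist x y.
Proof.
move=> fc; pose g (b : bool) (t : R^o) : R^o := if b then t else - t.
pose p (b : bool) := if b then x else y.
have bg b : bounded_linear (g b).
  split=> [a u v|]; first by case: b => //=; rewrite opprD scalerN.
  by exists 1 => t; rewrite mul1r; case: b => /=; rewrite ?normrN.
have gB : molecule_bound g p (mdist x y).
  move=> s sp z; rewrite big_bool/= mulrN -mulrBl normrM.
  by rewrite ler_wpM2r//; exact: (sp true false).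
have := fc _ _ _ _ _ bg (mdist_ge0 _ _) gB; apply: le_trans.
have := op_norm_ge_value (molecule_map_mem p f bg).
by rewrite /molecule_map big_bool/= scale1r scaleN1r.
Qed.

Lemma hull_lip0 X E (f : X -> E) : hull_mem f -> lip0 (f : X -> banach_pm E).
Proof.
move=> [f0 [c c0 fc]]; split=> //; exists c => // x y.
exact: hull_bound_lip.
Qed.

Lemma hull_lip_const_le X E (f : X -> E) :
  hull_mem f -> lip_const (f : X -> banach_pm E) <= hull_norm f.
Proof.
move=> fm; apply: lip_const_min; first exact: hull_norm_ge0.
by move=> x y; apply: hull_bound_lip; exact: hull_norm_bound.
Qed.

Lemma hull_boundL X E a (f f' : X -> E) (c c' : R) :
  hull_bound f c -> hull_bound f' c' -> hull_bound (a *: f + f') (`|a| * c + c').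
Proof.
move=> fc f'c G J g x B bg B0 gB.
have -> : molecule_map g x (a *: f + f') = a *: molecule_map g x f + molecule_map g x f'.
  apply/funext => z; rewrite -[RHS]/(a *: molecule_map g x f z + molecule_map g x f' z).
  rewrite /molecule_map scaler_sumr -big_split/=; apply: eq_bigr => i _.
  by rewrite scalerDr !scalerA [a * _]mulrC.
have mf := molecule_map_mem x f bg; have mf' := molecule_map_mem x f' bg.
rewrite (le_trans (op_normD (submoduleZ _ (op_mem_submodule A _ _) mf) mf'))//.
by rewrite op_normZ// mulrDl -mulrA lerD ?ler_wpM2l ?fc ?f'c.
Qed.

(** A crude estimate whose constant depends on the family of molecules; it suffices for pointwise
    limits, treated one family at a time. *)
Lemma hull_bound_finite X E G (J : finType) (g : J -> G -> R^o) (x : J -> X)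
    (f : X -> E) (d : R) :
  (forall i, bounded_linear (g i)) -> 0 <= d -> (forall i, `|f (x i)| <= d) ->
  op_norm A (molecule_map g x f) <= d * \sum_i opnorm (g i).
Proof.
move=> bg d0 fd; rewrite (le_trans (op_finite_rank _ _ _ bg).2)// mulr_sumr.
by apply: ler_sum => i _; rewrite ler_wpM2r// opnorm_ge0.
Qed.

Lemma hull_bound0 X E : hull_bound (0 : X -> E) 0.
Proof.
move=> G J g x B bg B0 gB.
have := @hull_bound_finite _ _ _ _ g x (0 : X -> E) 0 bg (lexx 0).
by rewrite !mul0r; apply => i; rewrite normr0.
Qed.

Lemma hull_mem_submodule X E : submodule (@hull_mem X E).
Proof.
split=> [|a f f' [f0 [c c0 fc]] [f'0 [c' c'0 f'c]]].
  by split=> //; exists 0 => //; exact: hull_bound0.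
split; first by rewrite -[LHS]/(a *: f point + f' point) f0 f'0 scaler0 addr0.
exists (`|a| * c + c'); last exact: hull_boundL.
by rewrite addr_ge0// mulr_ge0.
Qed.

Lemma hull_normZ_le X E a (f : X -> E) : hull_mem f ->
  hull_norm (a *: f) <= `|a| * hull_norm f.
Proof.
move=> fm; apply: hull_norm_le; first by rewrite mulr_ge0// hull_norm_ge0.
have := hull_boundL a (hull_norm_bound fm) (@hull_bound0 X E).
by rewrite !addr0.
Qed.

Lemma hull_norm_eq0 X E (f : X -> E) : hull_mem f -> hull_norm f = 0 -> f = 0.
Proof.
move=> fm f0; apply/funext => x; apply/normr0_eq0/eqP; rewrite eq_le normr_ge0 andbT.
have := hull_bound_lip x point (hull_norm_bound fm).
by rewrite f0 mul0r fm.1 subr0.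
Qed.

Lemma hull_normD X E (f f' : X -> E) : hull_mem f -> hull_mem f' ->
  hull_norm (f + f') <= hull_norm f + hull_norm f'.
Proof.
move=> fm f'm; apply: hull_norm_le; first by rewrite addr_ge0// hull_norm_ge0.
have := hull_boundL 1 (hull_norm_bound fm) (hull_norm_bound f'm).
by rewrite scale1r normr1 mul1r.
Qed.

Lemma hull_normZ X E a (f : X -> E) : hull_mem f ->
  hull_norm (a *: f) = `|a| * hull_norm f.
Proof.
move=> fm; apply/eqP; rewrite eq_le hull_normZ_le//=.
have [->|a0] := eqVneq a 0.
  rewrite normr0 mul0r scale0r hull_norm_ge0//.
  exact: (hull_mem_submodule X E).1.
rewrite -{1}[f](scalerK a0) -ler_pdivlMl ?normr_gt0// -normfV.
apply: hull_normZ_le; exact: submoduleZ (hull_mem_submodule X E) fm.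
Qed.

Lemma hull_complete X E (u : nat -> X -> E) : (forall n, hull_mem (u n)) ->
  (forall e, 0 < e -> exists n0 : nat, forall m n : nat,
    (n0 <= m)%N -> (n0 <= n)%N -> hull_norm (u m - u n) < e) ->
  exists2 l, hull_mem l & hull_norm (u n - l) @[n --> \oo] --> (0 : R).
Proof.
move=> um uc.
have smem := hull_mem_submodule X E.
have uB m n : hull_mem (u m - u n) by exact: submoduleB smem (um m) (um n).
have /choice[l ul] (x : X) : exists l : E, u n x @[n --> \oo] --> l.
  apply/cvg_ex; apply: cauchy_cvg; apply/cauchyP => e e0.
  have d1 : 0 < mdist x point + 1 :> R by rewrite ltr_wpDl// mdist_ge0.
  have [N Nu] := uc _ (divr_gt0 e0 d1).
  exists (u N x); exists N => // n /= Nn.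
  rewrite -ball_normE /ball_/=.
  have := hull_bound_lip x point (hull_norm_bound (uB N n)).
  rewrite (uB N n).1 subr0 => /le_lt_trans; apply.
  rewrite (@le_lt_trans _ _ (hull_norm (u N - u n) * (mdist x point + 1)))//.
    by rewrite ler_wpM2l ?hull_norm_ge0// lerDl.
  by rewrite -ltr_pdivlMr// Nu.
have l0 : l point = 0.
  apply: (cvg_unique (@norm_hausdorff _ E) (ul point)).
  by rewrite (_ : (fun n => u n point) = fun=> 0); [exact: cvg_cst|
    apply/funext => n; have [] := um n].
(* For a fixed family, [m] is taken so large that [u m - l] contributes at most [d]; neither [m] nor
   the family appears in the resulting constant [e]. The [+ 1] in [sg + 1] avoids dividing by
   zero. *)
have bound e : 0 < e -> exists n0 : nat, forall n, (n0 <= n)%N -> hull_bound (u n - l) e.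
  move=> e0; have [n0 n0u] := uc _ e0; exists n0 => n n0n G J g x B bg B0 gB.
  pose sg := \sum_i opnorm (g i).
  have sg0 : 0 <= sg by apply: sumr_ge0 => i _; exact: opnorm_ge0.
  apply/ler_addgt0Pr => d d0; have dg : 0 < d / (sg + 1) by rewrite divr_gt0// ltr_wpDl.
  have [m n0m ml] : exists2 m, (n0 <= m)%N &
      forall i, `|u m (x i) - l (x i)| <= d / (sg + 1).
    near \oo => m; exists m; first by near: m; exact: nbhs_infty_ge.
    near: m; apply: filter_forall => i.
    have /cvgrPdist_le/(_ _ dg) := ul (x i).
    by apply: filterS => m; rewrite distrC.
  have -> : molecule_map g x (u n - l) =
      molecule_map g x (u n - u m) + molecule_map g x (u m - l).
    apply/funext => z.
    rewrite -[RHS]/(molecule_map g x (u n - u m) z + molecule_map g x (u m - l) z).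
    rewrite /molecule_map -big_split/=; apply: eq_bigr => i _.
    rewrite -scalerDr; congr (_ *: _).
    rewrite -[LHS]/(u n (x i) - l (x i)).
    by rewrite -[RHS]/(u n (x i) - u m (x i) + (u m (x i) - l (x i))) subrKA.
  rewrite (le_trans (op_normD _ _))//; try exact: molecule_map_mem.
  rewrite lerD//.
    rewrite (le_trans (hull_norm_bound (uB n m) bg B0 gB))// ler_wpM2r//.
    by rewrite ltW// n0u.
  rewrite (le_trans (hull_bound_finite bg (ltW dg) ml))// -/sg.
  by rewrite mulrAC ler_pdivrMr ?ltr_wpDl// ler_wpM2l ?(ltW d0)// lerDl.
have ulm e n : 0 < e -> hull_bound (u n - l) e -> hull_mem (u n - l).
  move=> e0 ue; split; last by exists e => //; exact: ltW.
  by rewrite -[LHS]/(u n point - l point) l0 (um n).1 subrr.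
exists l.
  have [n0 n0b] := bound 1 ltr01.
  have -> : l = u n0 - (u n0 - l) by rewrite subKr.
  apply: (submoduleB smem (um n0)); apply: (ulm 1 n0 ltr01); exact: n0b.
apply/cvgrPdist_le => e e0; have [n0 n0b] := bound e e0; exists n0 => // n /= n0n.
have ue := n0b _ n0n.
rewrite sub0r normrN ger0_norm; last by apply: hull_norm_ge0; exact: ulm ue.
by apply: hull_norm_le => //; exact: ltW.
Unshelve. all: by end_near. Qed.

Lemma hull_banach X E : banach_component (@hull_mem X E) (@hull_norm X E).
Proof.
split.
- exact: hull_mem_submodule.
- by move=> f fm; split; [exact: hull_norm_ge0|exact: hull_norm_eq0].
- by move=> f f'; exact: hull_normD.
- by move=> a f; exact: hull_normZ.
- exact: hull_complete.
Qed.

Lemma hull_bound_id : hull_bound (@idfun R^o : banach_pm R^o -> R^o) 1.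
Proof.
move=> G J g x B bg B0 gB; rewrite mul1r.
have mapB z : `|molecule_map g x (@idfun R^o : banach_pm R^o -> R^o) z| <= B * `|z|.
  rewrite /molecule_map.
  under eq_bigr => i _ do rewrite [_ *: _]mulrC.
  exact: gB.
have bV : bounded_linear (molecule_map g x (@idfun R^o : banach_pm R^o -> R^o)).
  exact: op_bounded_linear (molecule_map_mem _ _ bg).
have [_] := op_norm_comp_le bV (op_id A).1 (bounded_linear_idfun R^o)
  (le_opnorm B0 mapB) (opnorm_idfun_le _).
by rewrite (op_id A).2 !mul1r.
Qed.

Lemma hull_id : hull_mem (@idfun R^o : banach_pm R^o -> R^o) /\
  hull_norm (@idfun R^o : banach_pm R^o -> R^o) = 1.
Proof.
have m : hull_mem (@idfun R^o : banach_pm R^o -> R^o).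
  by split=> //; exists 1 => //; exact: hull_bound_id.
split=> //; apply/eqP; rewrite eq_le hull_norm_le//=; last exact: hull_bound_id.
have := @hull_bound_lip (banach_pm R^o) R^o _ _ (1 : R^o) (0 : R^o) (hull_norm_bound m).
by rewrite banach_mdistE /= subr0 normr1 mulr1.
Qed.

Lemma hull_bound_comp X Y E F (h : Y -> X) (f : X -> E) (S : E -> F) (c : R) :
  lip0 h -> 0 <= c -> hull_bound f c -> bounded_linear S ->
  hull_bound (S \o f \o h) (lip_const h * c * opnorm S).
Proof.
move=> lh c0 fc bS G J g y B bg B0 gB.
have [L0 hL] := lip_constP lh; have S0 := opnorm_ge0 bS.
have SV : molecule_map g y (S \o f \o h) = S \o molecule_map g (h \o y) f \o idfun.
  apply/funext => z; rewrite /= /molecule_map (linear_fun_comb bS.1).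
  by [].
(* Rescaling molecules requires a positive constant, whereas [lip_const h] may be zero; the bound is
   proved for larger [C] and then passed to the limit. *)
have key (C : R) : 0 < C -> lip_const h <= C ->
    op_norm A (molecule_map g y (S \o f \o h)) <= opnorm S * (c * (C * B)).
  move=> C0 LC; have gC : molecule_bound g (h \o y) (C * B).
    move=> s hs; apply: (molecule_bound_scale C0 gB) => i j.
    by rewrite (le_trans (hs i j))// (le_trans (hL _ _))// ler_wpM2r// mdist_ge0.
  have [_] := op_norm_comp_le (bounded_linear_idfun G) (molecule_map_mem (h \o y) f bg)
    bS (opnorm_idfun_le _) (lexx (opnorm S)).
  rewrite SV mulr1 => /le_trans; apply; rewrite ler_wpM2l//.
  by apply: fc => //; rewrite mulr_ge0// ltW.
have k0 : 0 <= opnorm S * c * B by rewrite !mulr_ge0.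
apply/ler_addgt0Pr => e e0.
have k1 : 0 < opnorm S * c * B + 1 by rewrite ltr_wpDl.
have ek : 0 < e / (opnorm S * c * B + 1) by rewrite divr_gt0.
rewrite (le_trans (key (lip_const h + e / (opnorm S * c * B + 1)) _ _))//.
- by rewrite ltr_wpDl.
- by rewrite lerDl ltW.
rewrite (_ : opnorm S * _ = lip_const h * c * opnorm S * B +
    e * (opnorm S * c * B) / (opnorm S * c * B + 1)); last by ring.
by rewrite lerD2l ler_pdivrMr// ler_wpM2l ?ltW// ltrDl.
Qed.

Lemma hull_ideal Y X E F (h : Y -> X) (f : X -> E) (S : E -> F) :
  lip0 h -> hull_mem f -> bounded_linear S ->
  hull_mem (S \o f \o h) /\
  hull_norm (S \o f \o h) <= lip_const h * hull_norm f * opnorm S.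
Proof.
move=> lh fm bS; have f0 := hull_norm_ge0 fm.
have fc := hull_bound_comp lh f0 (hull_norm_bound fm) bS.
have c0 : 0 <= lip_const h * hull_norm f * opnorm S.
  by rewrite !mulr_ge0 ?opnorm_ge0//; have [] := lip_constP lh.
split; last exact: hull_norm_le.
split; last by exists (lip_const h * hull_norm f * opnorm S).
by rewrite /= lh.1 fm.1 (linear_fun0 bS.1).
Qed.

Definition lip_hull : banachLipIdeal R :=
  BanachLipIdeal hull_lip0 hull_banach hull_lip_const_le hull_id hull_ideal.

End LipHull.

(** * Translation invariance and maximality of the hull *)

Section LipHullProperties.
Context {R : realType} (A : banachOperatorIdeal R).
Implicit Types (X Y : pointedMetricType R) (E F G H : completeNormedModType R).

Section Translation.
Context (E F : completeNormedModType R) (S : pointedSubset (banach_pm E)) (x0 : subpm S).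
Context (f : subpm S -> F).

Let to_shift_subproof (x : subpm S) :
  ((subpm_val x : E) - (subpm_val x0 : E) : banach_pm E) \in ps_set (Defs.shift x0).
Proof. by apply/mem_set; exists (subpm_val x) => //; exact: set_mem (subpm_valP x). Qed.

Let to_shift (x : subpm S) : subpm (Defs.shift x0) := SubPM (to_shift_subproof x).

Let to_shiftK x : unshift (to_shift x) = x.
Proof. by apply: val_inj; rewrite /= subrK. Qed.

Let mdist_unshift (y z : subpm (Defs.shift x0)) :
  mdist (unshift y : subpm S) (unshift z) = mdist y z :> R.
Proof.
case: y z => [y ?] [z ?].
rewrite -[LHS]/(`|(y : E) + (subpm_val x0 : E) - ((z : E) + (subpm_val x0 : E))|).
by rewrite opprD addrACA subrr addr0.
Qed.

Let molecule_map_translate G (J : finType) (g : J -> G -> R^o)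
    (y : J -> subpm (Defs.shift x0)) B :
  molecule_bound g y B ->
  molecule_map g y (translate f) = molecule_map g (fun i => unshift (y i) : subpm S) f.
Proof.
move=> gB; apply/funext => z; rewrite /molecule_map /translate.
under eq_bigr do rewrite scalerBr.
by rewrite sumrB -scaler_suml (molecule_bound_total z gB) scale0r subr0.
Qed.

(** Translating moves the points by an isometry and changes [f] by a constant, which molecules of
    total mass zero ignore. *)
Lemma hull_bound_translate c : hull_bound A f c <-> hull_bound A (@translate R E F S x0 f) c.
Proof.
split=> fc G J g x B bg B0 gB.
  rewrite (molecule_map_translate gB); apply: fc => // s sx; apply: gB => i j.
  by rewrite -mdist_unshift; exact: sx.
have gB' : molecule_bound g (fun i => to_shift (x i)) B.
  move=> s sx; apply: gB => i j.
  by rewrite -(to_shiftK (x i)) -(to_shiftK (x j)) mdist_unshift; exact: sx.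
have -> : molecule_map g x f = molecule_map g (fun i => to_shift (x i)) (translate f).
  rewrite (molecule_map_translate gB').
  by apply/funext => z; apply: eq_bigr => i _; rewrite to_shiftK.
exact: fc.
Qed.

End Translation.

Lemma lip_hull_translation_invariant : translation_invariant (lip_hull A).
Proof.
move=> E F S x0 f lf.
have E1 : @hull_bound R A _ _ (@translate R E F S x0 f) = hull_bound A f.
  by apply/funext => c; apply/propext; exact: iff_sym (hull_bound_translate x0 f c).
split; last by rewrite /= /hull_norm E1.
rewrite /= /hull_mem /= E1; split=> -[_ fc]; split=> //; last exact: lf.1.
rewrite /translate (_ : unshift point = x0) ?subrr//.
by apply: val_inj; rewrite /= add0r.
Qed.

(** A molecule map sees [f] at finitely many points only. Composed with a quotient and restricted to
    a subspace, it is a molecule map of the corresponding quotient of [f] on a finite set, so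
    maximality of [A] carries over. *)
Lemma lip_hull_maximal : op_maximal A -> lip_maximal (lip_hull A).
Proof.
move=> Amax X E f lf.
have le_max : lip_mem (lip_hull A) f ->
    (lip_max_norm (lip_hull A) f <= (lip_norm (lip_hull A) f)%:E)%E.
  move=> fm; apply: ge_ereal_sup => _ [X0 [M [fX0 fM ->]]].
  have [val0 val1] : lip0 (@subpm_val R X X0) /\ lip_const (@subpm_val R X X0) <= 1.
    exact: lip0_isometry.
  have [m n] := lip_norm_comp_le val0 fm (bounded_linear_quot_pi M) val1 (opnorm_quot_pi_le M).
  by rewrite /lip_enorm asboolT// lee_fin; move: n; rewrite mul1r mulr1.
have max_bound c : 0 <= c -> (lip_max_norm (lip_hull A) f <= c%:E)%E -> hull_bound A f c.
  move=> c0 fc G J g x B bg B0 gB.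
  have AV := molecule_map_mem A x f bg.
  rewrite -lee_fin ((Amax _ _ _ (op_bounded_linear AV)).2 AV).
  apply: ge_ereal_sup => _ [G0 [M [fG0 fM ->]]].
  pose X0s := [set point] `|` range x.
  pose X0 : pointedSubset X := @PointedSubset R X X0s (or_introl erefl).
  have fX0 : finite_set (ps_set X0).
    by rewrite /= /X0s finite_setU; split; [exact: finite_set1|exact: finite_image].
  have xX0 i : x i \in ps_set X0 by apply/mem_set; right; exists i.
  pose x' i : subpm X0 := SubPM (xX0 i).
  have -> : quot_pi M \o molecule_map g x f \o @subsp_val R G G0 =
      molecule_map (fun i => g i \o @subsp_val R G G0) x'
        (quot_pi M \o f \o @subpm_val R X X0).
    apply/funext => z; rewrite /= /molecule_map.
    by rewrite (linear_fun_comb (bounded_linear_quot_pi M).1).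
  have bg' i : bounded_linear (g i \o @subsp_val R G G0).
    exact: bounded_linear_comp (bounded_linear_subsp_val _) (bg i).
  rewrite /op_enorm asboolT; last exact: molecule_map_mem.
  have : (lip_enorm (lip_hull A) (quot_pi M \o f \o @subpm_val R X X0) <= c%:E)%E.
    by apply: le_trans fc; apply: ereal_sup_ubound; exists X0, M.
  rewrite /lip_enorm; case: asboolP => // qm; rewrite !lee_fin => qc.
  rewrite (@le_trans _ _ (lip_norm (lip_hull A) (quot_pi M \o f \o @subpm_val R X X0) * B))//.
    apply: (hull_norm_bound qm) => // s sx z /=.
    by apply: gB.
  by rewrite ler_wpM2r.
(* Rules out [-oo], so that a finite supremum is a nonnegative real: the zero quotient and the
   one-point subset already contribute a nonnegative term. *)
have max_ge0 : (0 <= lip_max_norm (lip_hull A) f)%E.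
  have M0 : closed (setT : set E) by exact: closedT.
  pose M : closedSubspace E := @ClosedSubspace R E setT Logic.I (fun _ _ _ _ _ => Logic.I) M0.
  pose X0 : pointedSubset X := @PointedSubset R X [set point] erefl.
  apply: (@le_trans _ _ (lip_enorm (lip_hull A) (quot_pi M \o f \o @subpm_val R X X0))).
    rewrite /lip_enorm; case: asboolP => // qm; rewrite lee_fin.
    exact: (hull_norm_ge0 qm).
  apply: ereal_sup_ubound; exists X0, M; split => //; first exact: finite_set1.
  exists 0%N, (fun _ => 0) => v; exists (fun _ => 0); rewrite big_ord0.
  rewrite -[v]quot_pi_repr -(linear_fun0 (bounded_linear_quot_pi M).1).
  exact/quot_pi_eq.
have mem_max : (lip_max_norm (lip_hull A) f < +oo)%E ->
    lip_mem (lip_hull A) f /\ ((lip_norm (lip_hull A) f)%:E <= lip_max_norm (lip_hull A) f)%E.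
  case: (lip_max_norm (lip_hull A) f) max_ge0 max_bound => // r r0 /(_ r r0 (lexx _)) fr _.
  split; last by rewrite lee_fin; apply: hull_norm_le.
  by split; [exact: lf.1|exists r].
split; first by split=> [/le_max/le_lt_trans|/mem_max[]//]; apply; exact: ltry.
move=> fm; apply/eqP; rewrite eq_le le_max// andbT.
by apply: (mem_max _).2; apply: le_lt_trans (le_max fm) _; exact: ltry.
Qed.

(** McShane's formula. It passes from test functions on the indices of a family of molecules to
    functions on the whole space. *)
Lemma mcshane_extension X (J : Type) (x : J -> X) (s : J -> R) : inhabited J ->
  (forall i j, `|s i - s j| <= mdist (x i) (x j)) ->
  exists2 S : X -> R, (forall p q, `|S p - S q| <= mdist p q) & forall i, S (x i) = s i.
Proof.
move=> [i0] sx.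
pose V p := [set s i + mdist p (x i) | i in [set: J]].
have Vlb p : has_inf (V p).
  split; first by exists (s i0 + mdist p (x i0)), i0.
  exists (s i0 - mdist p (x i0)) => _ [i _ <-].
  rewrite lerBlDr -addrA -lerBlDl (le_trans (ler_norm _))// (le_trans (sx _ _))//.
  by rewrite addrC [mdist p (x i0)]metric_sym metric_triangle.
have le1 p q : inf (V p) - inf (V q) <= mdist p q.
  rewrite lerBlDl -lerBlDr; apply: lb_le_inf; first exact: (Vlb q).1.
  move=> _ [i _ <-]; rewrite lerBlDr.
  rewrite (@le_trans _ _ (s i + mdist p (x i)))//.
    by apply: ge_inf; [exact: (Vlb p).2|exists i].
  by rewrite -addrA lerD2l addrC metric_triangle.
exists (fun p => inf (V p)) => [p q|i].
  by rewrite ler_norml le1 andbT lerNl opprB metric_sym le1.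
apply/eqP; rewrite eq_le; apply/andP; split.
  by apply: ge_inf; [exact: (Vlb _).2|exists i; rewrite // mdistxx addr0].
apply: lb_le_inf; first exact: (Vlb _).1.
by move=> _ [j _ <-]; rewrite -lerBlDl (le_trans (ler_norm _)).
Qed.

End LipHullProperties.

Section BoundedFunctionNorm.
Context {R : realType} (T : Type).
Implicit Type w : T -> R^o.

Definition bdd_norm w : R := inf [set C : R | 0 <= C /\ forall i, `|w i| <= C].

Lemma bdd_norm_le w (C : R) : 0 <= C -> (forall i, `|w i| <= C) -> bdd_norm w <= C.
Proof. by move=> C0 wC; apply: ge_inf; [exists 0 => D []|]. Qed.

Let bdd_norm_ne w : bdd w -> [set C : R | 0 <= C /\ forall i, `|w i| <= C] !=set0.
Proof.
by move=> [C wC]; exists `|C|; split=> // i; rewrite (le_trans (wC i))// ler_norm.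
Qed.

Lemma bdd_norm_ge w i : bdd w -> `|w i| <= bdd_norm w.
Proof. by move=> /bdd_norm_ne w0; apply: lb_le_inf => // C [_]; exact. Qed.

Lemma bdd_norm_ge0 w : bdd w -> 0 <= bdd_norm w.
Proof. by move=> /bdd_norm_ne w0; apply: lb_le_inf => // C []. Qed.

Lemma sublinear_bdd_norm (K : R) : 0 <= K ->
  sublinear_on (@bdd R T) (fun w => K * bdd_norm w).
Proof.
move=> K0; split=> [u v bu bv|a u a0 bu].
  rewrite -mulrDr ler_wpM2l// bdd_norm_le ?addr_ge0 ?bdd_norm_ge0// => i.
  by rewrite (le_trans (ler_normD _ _))// lerD// bdd_norm_ge.
rewrite mulrCA ler_wpM2l// bdd_norm_le ?mulr_ge0 ?bdd_norm_ge0// => i.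
by rewrite normrZ ger0_norm// ler_wpM2l// bdd_norm_ge.
Qed.

End BoundedFunctionNorm.

(** * The linear part of the hull *)

Section LinearPart.
Context {R : realType} (A : banachOperatorIdeal R).
Implicit Types E F G H : completeNormedModType R.

Section FiniteDimensionalDomain.
Context (G H : completeNormedModType R) (t : G -> H) (c : R).
Hypotheses (fG : finite_dim G) (bt : bounded_linear t) (c0 : 0 <= c).
Hypothesis tc : hull_bound A (t : banach_pm G -> H) c.

Lemma finite_dim_op_mem : op_mem A t.
Proof.
have [n [b [g [bg gE]]]] := finite_dim_coordinates fG.
rewrite (_ : t = fun z => \sum_(k < n) g k z *: t (b k)).
  exact: (op_finite_rank A _ _ bg).1.
by apply/funext => z; rewrite {1}(gE z) (linear_fun_comb bt.1).
Qed.

(* A functional [P] attaining the [A]-norm of [t], seen on combinations of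
   molecules through [s |-> s x - s 0], extends to a functional on the bounded
   functions on points times 1-Lipschitz functions, that is, to a finite
   sequence of Lipschitz functions [theta j]; replacing each of them by its
   invariant mean derivative makes it linear without changing the pairing. *)
Lemma hull_bound_finite_dim : op_norm A t <= c.
Proof.
have At := finite_dim_op_mem.
apply: (le_of_le_mul1B c0) => e e0 e1; have e1' : 0 < 1 - e by rewrite subr_gt0.
have [n [b [g [bg gE]]]] := finite_dim_coordinates fG.
have [m [z [z1 _ zl]]] := finite_dim_norming_points fG e0.
set K := c / (1 - e); have K0 : 0 <= K by rewrite divr_ge0// ltW.
rewrite -ler_pdivlMl// mulrC -/K.
have sA := op_mem_submodule A G H.
have [P [lP PA <-]] := hahn_banach_attained sA (op_norm_sublinear A G H) At.
pose S := {s : G -> R | forall x y, `|s x - s y| <= `|x - y|}.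
(* [ev h x] is the tensor of [h] and [delta_x - delta_0] as a bounded function. The sup norm of a
   sum of such tensors is its norm as an operator from [G] into the free space, up to the factor
   [1 - e] due to the points [z j]. *)
pose ev (h : G -> R^o) (x : G) : 'I_m * S -> R^o :=
  fun i => h (z i.1) * (sval i.2 x - sval i.2 0).
have evb h x : bounded_linear h -> bdd (ev h x).
  move=> bh; exists (opnorm h * `|x|) => -[j [s sx]] /=.
  rewrite normrM ler_pM//; last by rewrite (le_trans (sx _ _))// subr0.
  by rewrite (le_trans (opnorm_le _ bh))// ler_piMr// opnorm_ge0.
pose w (J : finType) (h : J -> G -> R^o) (x : J -> G) : 'I_m * S -> R^o :=
  fun i => \sum_k ev (h k) (x k) i.
pose V (J : finType) (h : J -> G -> R^o) (x : J -> G) : G -> H :=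
  fun y => \sum_k h k y *: t (x k).
have VA (J : finType) (h : J -> G -> R^o) (x : J -> G) :
    (forall k, bounded_linear (h k)) -> op_mem A (V J h x).
  by move=> bh; exact: (op_finite_rank A _ _ bh).1.
have wb (J : finType) (h : J -> G -> R^o) (x : J -> G) :
    (forall k, bounded_linear (h k)) -> bdd (w J h x).
  by move=> bh; apply: bdd_sum => k; exact: evb.
have bZ a (h : G -> R^o) : bounded_linear h -> bounded_linear (fun y => a * h y : R^o).
  move=> bh; split=> [r u v|]; first by rewrite bh.1 mulrDr; congr (_ + _); exact: mulrCA.
  by exists (`|a| * opnorm h) => y; rewrite normrM -mulrA ler_wpM2l// opnorm_le.
have PV (J : finType) (h : J -> G -> R^o) (x : J -> G) : (forall k, bounded_linear (h k)) ->
    P (V J h x) <= K * bdd_norm (w J h x).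
  move=> bh; rewrite (le_trans (PA _ (VA _ _ _ bh)))//.
  (* Molecules have total mass zero: an extra term at the point [0] balances the coefficients and
     leaves the map unchanged, because [t 0 = 0]. *)
  pose h' (k : J + 'I_1) : G -> R^o :=
    match k with inl k => h k | inr _ => fun y => -1 * \sum_k h k y end.
  pose x' (k : J + 'I_1) : banach_pm G := match k with inl k => x k | inr _ => 0 end.
  have bh' k : bounded_linear (h' k).
    by case: k => [k|k]; [exact: bh|apply: bZ; exact: bounded_linear_sum].
  have -> : V J h x = molecule_map h' x' (t : banach_pm G -> H).
    apply/funext => y; rewrite /molecule_map big_sumType big_ord1/=.
    by rewrite (linear_fun0 bt.1) scaler0 addr0.
  have B0 : 0 <= bdd_norm (w J h x) / (1 - e) 
    by apply: divr_ge0; [exact/bdd_norm_ge0/wb|exact: ltW].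
  rewrite (_ : K * _ = c * (bdd_norm (w J h x) / (1 - e))); last by rewrite mulrA mulrAC.
  apply: tc => // s sx y.
  have [Se Selip SeE] := mcshane_extension (inhabits (inr ord0)) sx.
  pose l y : R^o := \sum_k (s (inl k) - s (inr ord0)) * h k y.
  have bl : bounded_linear l by apply: bounded_linear_sum => k; exact: bZ.
  have -> : \sum_i s i * h' i y = l y.
    rewrite big_sumType big_ord1/= mulN1r mulrN mulr_sumr -sumrB.
    by apply: eq_bigr => k _; rewrite mulrBl.
  rewrite (le_trans (opnorm_le _ bl))// ler_wpM2r// ler_pdivlMr// mulrC.
  apply: zl => // j.
  have -> : l (z j) = w J h x (j, exist _ Se Selip).
    apply: eq_bigr => k _; rewrite /ev/= mulrC -(SeE (inl k)) -(SeE (inr ord0)).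
    by [].
  exact/bdd_norm_ge/wb.
pose C w' r := exists (J : finType) (h : J -> G -> R^o) (x : J -> G),
  [/\ forall k, bounded_linear (h k), w' = w J h x & r = P (V J h x)].
have [||||L [lL LK LC]] := @mazur_orlicz _ _ (@bdd R ('I_m * S)) (fun w => K * bdd_norm w)
  C (submodule_bdd _) (sublinear_bdd_norm _ K0).
- exists 'I_0, (fun _ _ => 0), (fun _ => 0); split => [[]//||].
    by apply/funext => i; rewrite /w big_ord0.
  rewrite -[LHS](linear_on0 sA lP); congr P; apply/funext => y.
  by rewrite /V big_ord0.
- move=> _ _ _ _ [J [h [x [bh -> ->]]]] [J' [h' [x' [bh' -> ->]]]].
  exists (J + J')%type, (fun k => match k with inl k => h k | inr k => h' k end),
    (fun k => match k with inl k => x k | inr k => x' k end); split.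
  + by case.
  + by apply/funext => i; rewrite /w big_sumType.
  + rewrite -(linear_onD lP); [|exact: VA..]; congr P.
    by apply/funext => y; rewrite /V big_sumType.
- move=> a _ _ a0 [J [h [x [bh -> ->]]]]; exists J, (fun k y => a * h k y), x; split.
  + by move=> k; exact: bZ.
  + apply/funext => i; rewrite -[LHS]/(a * w J h x i) /w mulr_sumr.
    by apply: eq_bigr => k _; rewrite mulrA.
  + rewrite -(linear_onZ _ sA lP); last exact: VA; congr P.
    apply/funext => y; rewrite -[LHS]/(a *: V J h x y) /V scaler_sumr.
    by apply: eq_bigr => k _; rewrite scalerA.
- by move=> _ _ [J [h [x [bh -> ->]]]]; split; [exact: wb|exact: PV].
have r1A (h : G -> R^o) x : bounded_linear h -> op_mem A (fun y => h y *: t x).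
  by move=> bh; exact: (op_rank1 A _ bh).1.
have LE (h : G -> R^o) x : bounded_linear h -> L (ev h x) = P (fun y => h y *: t x).
  move=> bh.
  have le1 (h' : G -> R^o) : bounded_linear h' -> P (fun y => h' y *: t x) <= L (ev h' x).
    move=> bh'; apply: LC; exists 'I_1, (fun=> h'), (fun=> x); split => //.
      by apply/funext => i; rewrite /w big_ord1.
    by congr P; apply/funext => y; rewrite /V big_ord1.
  apply/eqP; rewrite eq_le le1// andbT.
  have := le1 _ (bZ (-1) _ bh).
  have -> : ev (fun y => -1 * h y) x = - ev h x.
    by apply/funext => i; rewrite /ev mulN1r mulNr.
  have -> : (fun y => (-1 * h y) *: t x) = - (fun y => h y *: t x).
    by apply/funext => y; rewrite mulN1r scaleNr.
  rewrite (linear_onN (submodule_bdd _) lL); last exact: evb.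
  by rewrite (linear_onN sA lP) ?lerN2//; exact: r1A.
(* The slice over [z j]: [ev h x] is the combination of the [d j x] with coefficients [h (z j)], so
   [L] is described by the functions [theta j]. *)
pose d j x : 'I_m * S -> R^o := fun i => (i.1 == j)%:R * (sval i.2 x - sval i.2 0).
have db j x : bdd (d j x).
  exists `|x| => -[i [s sx]] /=; rewrite /d normrM /=.
  rewrite (le_trans (ler_piMl _ _))//; first by case: (i == j); rewrite ?normr1 ?normr0.
  by rewrite (le_trans (sx _ _))// subr0.
pose theta j x : R := L (d j x).
have Ltheta (h : G -> R^o) x : bounded_linear h ->
    P (fun y => h y *: t x) = \sum_j h (z j) * theta j x.
  move=> bh; rewrite -LE//.
  have -> : ev h x = \sum_j h (z j) *: d j x.
    apply/funext => -[i s]; rewrite fct_sumE (bigD1 i)//= big1 => [|j ji].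
      rewrite addr0 -[RHS]/(h (z i) * ((i == i)%:R * (sval s x - sval s 0))).
      by rewrite eqxx mul1r.
    rewrite -[LHS]/(h (z j) * ((i == j)%:R * (sval s x - sval s 0))).
    by rewrite eq_sym (negbTE ji) mul0r mulr0.
  rewrite (linear_on_sum _ (submodule_bdd _) lL).
    by apply: eq_bigr => j _; rewrite (linear_onZ _ (submodule_bdd _) lL).
  by move=> j _; apply: submoduleZ => //; exact: submodule_bdd.
(* The slices have disjoint supports, so [K] bounds the whole sum and not merely each term; the
   final estimate depends on this. *)
have theta_sum (p q : 'I_m -> G) (a : R) : 0 <= a -> (forall j, `|p j - q j| <= a) ->
    \sum_j (theta j (p j) - theta j (q j)) <= K * a.
  move=> a0 pq.
  have pqb j : bdd (d j (p j) - d j (q j)) by exact: submoduleB (submodule_bdd _) _ _.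
  have -> : \sum_j (theta j (p j) - theta j (q j)) = L (\sum_j (d j (p j) - d j (q j))).
    rewrite (linear_on_sum _ (submodule_bdd _) lL)//; apply: eq_bigr => j _.
    rewrite (linear_onD lL)//; last exact: submoduleN (submodule_bdd _) _.
    by rewrite (linear_onN (submodule_bdd _) lL).
  rewrite (le_trans (LK _ (submodule_sum _ (submodule_bdd _) _)))//.
  rewrite ler_wpM2l// bdd_norm_le// => -[i [s sx]].
  rewrite fct_sumE (bigD1 i)//= big1 => [|j ji].
    rewrite addr0 -[X in `|X|]/((i == i)%:R * (s (p i) - s 0) - (i == i)%:R * (s (q i) - s 0)).
    rewrite eqxx !mul1r opprB addrA subrK.
    exact: le_trans (sx _ _) (pq i).
  rewrite -[LHS]/((i == j)%:R * (s (p j) - s 0) - (i == j)%:R * (s (q j) - s 0)).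
  by rewrite eq_sym (negbTE ji) !mul0r subr0.
have theta_lip j x y : `|theta j x - theta j y| <= K * `|x - y|.
  suff le1 p q : theta j p - theta j q <= K * `|p - q|.
    by rewrite ler_norml le1 andbT lerNl opprB -normrN opprB le1.
  have := theta_sum (fun i => if i == j then p else 0) (fun i => if i == j then q else 0).
  move=> /(_ `|p - q| (normr_ge0 _)); rewrite (bigD1 j)//= eqxx big1 ?addr0.
    by apply => i; case: (i == j) => //; rewrite subrr normr0.
  by move=> i ij; rewrite (negbTE ij) subrr.
have [M [mM Minv]] : exists M : (G -> R^o) -> R,
    mean M /\ forall (h : G -> R^o) x, bdd h -> M (fun y => h (y + x)) = M h.
  exact: invariant_mean.
pose dtheta j x (y : G) : R^o := theta j (x + y) - theta j y.
have dthetaB j x y : `|dtheta j x y| <= K * `|x|.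
  by rewrite (le_trans (theta_lip _ _ _))// addrK.
have dthetab j x : bdd (dtheta j x) by exists (K * `|x|) => y; exact: dthetaB.
pose D j x : R^o := M (dtheta j x).
have lD j : linear (D j).
  apply: (@additive_bounded_linear _ _ _ _ K) => [x x'|x]; last exact: (mean_norm mM).
  rewrite /D -(Minv _ x' (dthetab j x)) -(meanD mM)//; last first.
    by exists (K * `|x|) => y; exact: dthetaB.
  congr M; apply/funext => y; rewrite /dtheta [y + x']addrC.
  by rewrite subrKA addrA.
(* As [t] is linear, replacing [t x] by [t (x + y) - t y] changes nothing for any [y]; averaging
   over [y] then turns [theta j] into the linear [D j]. *)
have PD k x : P (fun y => g k y *: t x) = \sum_j g k (z j) * D j x.
  rewrite -[LHS](mean_cst mM) /D.
  transitivity (M (fun y => \sum_j g k (z j) * dtheta j x y)).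
    congr M; apply/funext => y; rewrite /dtheta.
    under eq_bigr do rewrite mulrBr.
    rewrite sumrB -!Ltheta//.
    have -> : (fun y0 => g k y0 *: t (x + y)) =
        (fun y0 => g k y0 *: t x) + (fun y0 => g k y0 *: t y).
      by apply/funext => y0; rewrite (linear_funD bt.1) scalerDr.
    by rewrite (linear_onD lP) ?addrK//; exact: r1A.
  rewrite (mean_sum mM) => [|j]; last exact: bddZ.
  by apply: eq_bigr => j _; rewrite (meanZ mM).
have -> : P t = \sum_j D j (z j).
  have -> : t = \sum_k (fun y => g k y *: t (b k)).
    by apply/funext => y; rewrite fct_sumE {1}(gE y) (linear_fun_comb bt.1).
  rewrite (linear_on_sum _ sA lP) => [|k _]; last exact: r1A.
  under eq_bigr do rewrite PD.
  rewrite exchange_big/=; apply: eq_bigr => j _.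
  by rewrite [in RHS](gE (z j)) (linear_fun_comb (lD j)).
(* For every [y] the averaged sum is at most [K], since [z j + y] and [y] are at distance at most
   [1]. *)
rewrite /D -(mean_sum mM)//; apply: (mean_le mM) => [|y]; first exact: bdd_sum.
rewrite -[K]mulr1; apply: theta_sum => // j.
by rewrite addrK.
Qed.

End FiniteDimensionalDomain.

(** That the hull norm is at most the norm in [A] holds because molecule maps of [T] factor through
    [T]; for the converse, maximality of [A] reduces to finite-dimensional domains. *)
Lemma lip_hull_linear_part : op_maximal A -> linear_part_eq (lip_hull A) A.
Proof.
move=> Amax E F T.
have le_hull : op_mem A T -> hull_bound A (T : banach_pm E -> F) (op_norm A T).
  move=> AT G J g x B bg B0 gB.
  (* The barycenter of the molecules. Norming functionals are 1-Lipschitz test functions, so [u] has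
     norm at most [B]. *)
  pose u (y : G) : E := \sum_i g i y *: (x i : E).
  have uB y : `|u y| <= B * `|y|.
    have [f [bf <- f1]] := norming_functional (u y).
    rewrite (linear_fun_comb bf.1) (le_trans (ler_norm _))//.
    under eq_bigr do rewrite [_ *: _]mulrC.
    apply: gB => i j; rewrite -(linear_funB bf.1); exact: f1.
  have bu : bounded_linear u.
    by apply: bounded_linear_sum => i; exact: bounded_linear_rank1.
  have [_] := op_norm_comp_le bu AT (bounded_linear_idfun F) (le_opnorm B0 uB)
    (opnorm_idfun_le F).
  rewrite mul1r; apply: le_trans; rewrite (_ : molecule_map _ _ _ = idfun \o T \o u)//.
  by apply/funext => y; rewrite /= (linear_fun_comb (op_bounded_linear AT).1).
have hull_le : bounded_linear T -> lip_mem (lip_hull A) (T : banach_pm E -> F) ->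
    (op_max_norm A T <= (lip_norm (lip_hull A) (T : banach_pm E -> F))%:E)%E.
  move=> bT Tm; apply: ge_ereal_sup => _ [G [M [fG fM ->]]].
  set t := quot_pi M \o T \o _.
  have bt : bounded_linear t.
    apply: bounded_linear_comp; first exact: bounded_linear_subsp_val.
    by apply: bounded_linear_comp => //; exact: bounded_linear_quot_pi.
  have c0 := hull_norm_ge0 Tm.
  have [v0 v1] : lip0 (@subsp_val R E G : banach_pm (subsp G) -> banach_pm E) /\
      lip_const (@subsp_val R E G : banach_pm (subsp G) -> banach_pm E) <= 1.
    exact: lip0_isometry.
  have [tm tn] := lip_norm_comp_le v0 Tm (bounded_linear_quot_pi M) v1 (opnorm_quot_pi_le M).
  rewrite mul1r mulr1 in tn.
  rewrite /op_enorm asboolT; last exact: finite_dim_op_mem.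
  rewrite lee_fin; apply: hull_bound_finite_dim => //.
  move=> G' J g x B bg B0 gB; rewrite (le_trans (hull_norm_bound tm bg B0 gB))//.
  by rewrite ler_wpM2r.
have hull_mem_op : op_mem A T -> lip_mem (lip_hull A) (T : banach_pm E -> F).
  move=> AT; split; first exact: linear_fun0 (op_bounded_linear AT).1.
  by exists (op_norm A T); [exact: op_norm_ge0|exact: le_hull].
split; last first.
  move=> AT; apply/eqP; rewrite eq_le; apply/andP; split.
    by apply: hull_norm_le; [exact: op_norm_ge0|exact: le_hull].
  rewrite -lee_fin ((Amax _ _ _ (op_bounded_linear AT)).2 AT).
  exact: hull_le (op_bounded_linear AT) (hull_mem_op AT).
split=> [AT|[bT Tm]]; first by split; [exact: op_bounded_linear AT|exact: hull_mem_op].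
by apply/(Amax _ _ _ bT).1; apply: le_lt_trans (hull_le bT Tm) _; exact: ltry.
Qed.

End LinearPart.

Theorem theorem2 (R : realType) (E F : completeNormedModType R)
    (E0 : closedSubspace E) (A : banachOperatorIdeal R)
    (T : subsp E0 -> dual F) :
  op_maximal A -> op_mem A T ->
  [<-> exists S : E -> dual F,
         [/\ op_mem A S, (forall x : subsp E0, S (subsp_val x) = T x) &
             op_norm A S = op_norm A T];
       forall I : banachLipIdeal R,
         lip_maximal I -> translation_invariant I -> linear_part_eq I A ->
         exists f : banach_pm E -> dual F,
           [/\ lip_mem I f, (forall x : subsp E0, f (subsp_val x) = T x) &
               lip_norm I f = op_norm A T];
       exists I : banachLipIdeal R,
         [/\ lip_maximal I, translation_invariant I, linear_part_eq I A &
             exists f : banach_pm E -> dual F,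
               [/\ lip_mem I f, (forall x : subsp E0, f (subsp_val x) = T x) &
                   lip_norm I f = op_norm A T]]].
Proof.
move=> Amax AT; split.
  move=> [S [AS ST SN]] I _ _ IA; have [memE normE] := IA _ _ S.
  by exists S; split=> //; [exact: (memE.1 AS).2|rewrite normE].
split.
  move=> all_I; exists (lip_hull A).
  have hmax := lip_hull_maximal Amax.
  have htr := lip_hull_translation_invariant A.
  have hlin := lip_hull_linear_part Amax.
  by split=> //; exact: all_I.
move=> [I [Imax Itr IA [f [If fT fN]]]].
have [S [bS IS NS ST]] :=
  linear_extension Imax Itr If (op_bounded_linear AT).1 fT.
have [memE normE] := IA _ _ S; have AS : op_mem A S by apply/memE.
(* Averaging gives one inequality; the other holds because [T] is [S] composed with the inclusion of
   [E0], of norm at most one. *)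
exists S; split=> //; apply/eqP; rewrite eq_le -normE// -fN NS/= normE// fN.
have [_] := op_norm_comp_le (bounded_linear_subsp_val E0) AS
  (bounded_linear_idfun _) (opnorm_subsp_val_le _) (opnorm_idfun_le _).
rewrite mul1r mulr1 (_ : _ \o _ \o _ = T)//.
exact/funext.
Qed.
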